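(* Let $\beta\in(0,\infty)$, $\gamma>0$, and for each $N\ge1$ let $K=K_N$ with $K_N/N\to\beta$. Let $\boldsymbol S=[\boldsymbol s_1,\dots,\boldsymbol s_K]\in\mathbb{R}^{N\times K}$ be a random time-hopping matrix with $N_{\mathsf s}=1$: its columns are independent, $\boldsymbol s_k=\epsilon_k\boldsymbol e_{\pi_k}$ with $\pi_k$ uniform on $\{1,\dots,N\}$ and $\epsilon_k$ uniform on $\{-1,+1\}$, all independent. Consider $\boldsymbol y=\boldsymbol S\boldsymbol b+\boldsymbol n$ with $\boldsymbol b$ having i.i.d. $\mathcal{CN}(0,\mathcal E)$ entries, $\boldsymbol n\sim\mathcal{CN}(\boldsymbol0,\mathcal N_0\boldsymbol I_N)$, $\boldsymbol b,\boldsymbol n,\boldsymbol S$ independent, and $\gamma=\mathcal E/\mathcal N_0$. For $\alpha\ge0$ let $\boldsymbol W^{\mathsf T}(\alpha)=\boldsymbol S^{\mathsf T}(\boldsymbol S\boldsymbol S^{\mathsf T}+\alpha\boldsymbol I)^{-1}$ for $\alpha>0$, and $\boldsymbol W^{\mathsf T}(0)=\lim_{\alpha\to0^+}\boldsymbol W^{\mathsf T}(\alpha)=\boldsymbol S^{+}$ (Moore–Penrose pseudoinverse). Let $r_1$ be the first entry of $\boldsymbol W^{\mathsf T}(\alpha)\boldsymbol y$, with either $\alpha=0$ (decorrelator) or $\alpha=1/\gamma$ (MMSE). Then, as $N\to\infty$, \[ \beta\,I(\mathsf b_1;r_1\mid\boldsymbol S)\ \to\ \beta\sum_{k\ge0}\frac{\beta^k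 e^{-\beta}}{k!}\log_2\!\Big(1+\frac{\gamma}{k\gamma+1}\Big), \] mutual information being in bits; in particular the limit does not depend on $\alpha$.
   Context: $\boldsymbol e_i$ denotes the $i$th standard basis vector of $\mathbb R^N$; $\mathcal{CN}$ denotes the circularly symmetric complex Gaussian distribution. *)

(* Defs.v *)
From HB Require Import structures.
From mathcomp Require Import all_boot all_order all_algebra.
From mathcomp Require Import all_classical all_reals all_analysis.
Set Implicit Arguments. Unset Strict Implicit. Unset Printing Implicit Defensive.
Import Order.TTheory GRing.Theory Num.Theory.
Import numFieldNormedType.Exports.
Local Open Scope classical_set_scope.
Local Open Scope ring_scope.

Section Defs.
Context {R : realType}.

Definition log2 (x : R) : R := ln x / ln 2.

(** finite measurable partitions of C = R x R *)
Definition is_partition (m : nat) (A : 'I_m -> set (R * R)) : Prop :=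
  (forall i, measurable (A i)) /\
  (forall i j, i != j -> A i `&` A j = set0) /\
  (forall z, exists i, A i z).

Section MI.
Context {T : Type} (q : set T -> R) (X Y : T -> R * R).

Definition mi_part (m1 m2 : nat) (A : 'I_m1 -> set (R * R))
    (B : 'I_m2 -> set (R * R)) : R :=
  \sum_(i < m1) \sum_(j < m2)
    (let pij := q (X @^-1` A i `&` Y @^-1` B j) in
     if pij == 0 then 0
     else pij * log2 (pij / (q (X @^-1` A i) * q (Y @^-1` B j)))).

(** general (Dobrushin / Pinsker) mutual information: supremum over finite
    measurable partitions, in bits, as an extended real *)
Definition mutual_info : \bar R :=
  ereal_sup [set x | exists (m1 m2 : nat) (A : 'I_m1 -> set (R * R))
                            (B : 'I_m2 -> set (R * R)),
      [/\ is_partition A, is_partition B & x = (mi_part A B)%:E]].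
End MI.

(** values of a time-hopping matrix with N_s = 1: column k is
    eps_k e_{pi_k}; (s k).1 = pi_k, (s k).2 = (eps_k == +1);
    K = K'.+1 columns, N = N'.+1 rows *)
Definition SType (K' N' : nat) := {ffun 'I_K'.+1 -> 'I_N'.+1 * bool}.

Definition Smx K' N' (s : SType K' N') : 'M[R]_(N'.+1, K'.+1) :=
  \matrix_(i, j) (if (s j).1 == i then (if (s j).2 then 1 else -1) else 0).

Definition Wreg K' N' (s : SType K' N') (a : R) : 'M[R]_(K'.+1, N'.+1) :=
  (Smx s)^T *m invmx (Smx s *m (Smx s)^T + a%:M).

Definition Wdec K' N' (s : SType K' N') : 'M[R]_(K'.+1, N'.+1) :=
  \matrix_(i, j) lim (Wreg s a i j @[a --> 0^'+]).

Definition West K' N' (s : SType K' N') (a : R) : 'M[R]_(K'.+1, N'.+1) :=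
  if a == 0 then Wdec s else Wreg s a.

Section Model.
Context {d : measure_display} {T : measurableType d} (P : probability T R).
Context (K' N' : nat) (S : T -> SType K' N')
  (bR bI : 'I_K'.+1 -> T -> R) (nR nI : 'I_N'.+1 -> T -> R).

Definition Idx := (('I_K'.+1 + 'I_K'.+1) + ('I_N'.+1 + 'I_N'.+1))%type.

Definition Zfam (j : Idx) : T -> R :=
  match j with
  | inl (inl k) => bR k | inl (inr k) => bI k
  | inr (inl i) => nR i | inr (inr i) => nI i end.

(** the stochastic model, for fixed N = N'.+1, K = K'.+1:
    S uniform over all time-hopping matrices (i.e. pi_k, eps_k independent
    uniform), b_k ~ CN(0,E) (i.i.d. real and imaginary parts N(0,E/2)),
    n_j ~ CN(0,N0), and S, b, n mutually independent *)
Definition th_model (E N0 : R) : Prop :=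
  [/\ (forall s, measurable [set w | S w = s]) /\
      (forall j, measurable_fun setT (Zfam j)),
      (forall s, P [set w | S w = s] = ((2 * N'.+1) ^ K'.+1)%:R^-1%:E),
      (forall k (A : set R), measurable A ->
         P (bR k @^-1` A) = normal_prob 0 (Num.sqrt (E / 2)) A /\
         P (bI k @^-1` A) = normal_prob 0 (Num.sqrt (E / 2)) A),
      (forall i (A : set R), measurable A ->
         P (nR i @^-1` A) = normal_prob 0 (Num.sqrt (N0 / 2)) A /\
         P (nI i @^-1` A) = normal_prob 0 (Num.sqrt (N0 / 2)) A) &
      (forall s (A : Idx -> set R), (forall j, measurable (A j)) ->
         fine (P ([set w | S w = s] `&` [set w | forall j, A j (Zfam j w)]))
         = fine (P [set w | S w = s]) *
           \prod_(j : Idx) fine (P (Zfam j @^-1` A j)))].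

Definition b1 : T -> R * R := fun w => (bR ord0 w, bI ord0 w).

Definition yR (w : T) (i : 'I_N'.+1) : R :=
  \sum_(k < K'.+1) Smx (S w) i k * bR k w + nR i w.
Definition yI (w : T) (i : 'I_N'.+1) : R :=
  \sum_(k < K'.+1) Smx (S w) i k * bI k w + nI i w.

Definition r1 (a : R) : T -> R * R := fun w =>
  (\sum_(i < N'.+1) West (S w) a ord0 i * yR w i,
   \sum_(i < N'.+1) West (S w) a ord0 i * yI w i).

Definition condP (s : SType K' N') (A : set T) : R :=
  fine (P (A `&` [set w | S w = s])) / fine (P [set w | S w = s]).

Definition cond_mi (X Y : T -> R * R) : \bar R :=
  (\sum_(s : SType K' N') (P [set w | S w = s] * mutual_info (condP s) X Y))%E.

End Model.
End Defs.

(* Main.v *)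
Require Import Defs.
From HB Require Import structures.
From mathcomp Require Import all_boot all_order all_algebra.
From mathcomp Require Import all_classical all_reals all_analysis.
From mathcomp Require Import measurable_realfun.
From mathcomp Require Import ring lra zify.
Set Implicit Arguments. Unset Strict Implicit. Unset Printing Implicit Defensive.
Import Order.TTheory GRing.Theory Num.Theory.
Import numFieldNormedType.Exports.
Local Open Scope classical_set_scope.
Local Open Scope ring_scope.

(* Given the hopping matrix, S S^T is diagonal, so row 1 of the receiver matrix is supported
   on the chip of user 1 and r_1 is a positive multiple of b_1 + G. Here G is the Gaussian
   noise of that chip plus the (sign-corrected) symbols of the k other users hopping to it,
   so it is independent of b_1, of variance k E + N_0 whatever alpha is. Hence the conditional
   mutual information is that of a Gaussian channel, log2 (1 + gamma / (k gamma + 1)). As k is binomial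
   with parameters K - 1 and 1/N, it converges to a Poisson variable of mean beta, and Tannery's
   theorem passes to the limit in its expectation.

   For the mutual information, defined as a supremum over finite partitions, let l be the
   logarithm of the density of the joint law with respect to the product of the marginals. The
   contribution of a cell of joint mass p and product mass m is p ln (p / m). By Jensen's
   inequality it is at most the integral of l over the cell. Conversely, on the cells of a fine grid
   of a large box l is nearly constant and the contribution is nearly this integral, while any
   other cell contributes at least p - m. So the supremum is the mean of l. *)

(** * Mutual information as the mean of the information density *)

(** The model prescribes probabilities of product events only, and the supremum over partitions sees
    product events only. The information density therefore enters through one identity on such
    events, that [expR (- l)] integrates to the product of the two marginal probabilities, rather
    than through a Radon-Nikodym derivative of the joint law. For a Gaussian channel [l] is
    unbounded, so no finite partition makes it nearly constant on every cell. This forces the box,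
    and a bound on the remaining cells that ignores [l]: their [p - m] sum to at least minus the
    product mass outside the box, which vanishes as the box grows. Laws of sums need more than
    product events. [product_law] extends independence of a pair from rectangles to all measurable
    sets while a further event [D] is carried along, so that variables can be merged one at a time;
    real and imaginary parts are treated as separate real Gaussians. The factor in front of b_1 + G,
    the only place where alpha survives, is invisible because rescaling is invertible and partitions
    can be pulled back along it. *)

Section Grid.
Context {R : realType}.

Definition interval_box (r : R) : set (R * R) :=
  [set z | (- r <= z.1 < r) /\ (- r <= z.2 < r)].

(** The value [None] is the single unbounded cell of the line. It would also catch an index beyond
    [m], which [line_grid_total] excludes once [m] is large enough. *)
Let line_grid (r h : R) (m : nat) (x : R) : option 'I_m :=
  if - r <= x < r then insub (Num.trunc ((x + r) / h)) else None.

Let line_grid_fiber r h m (k : 'I_m) x : 0 < h ->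
  (line_grid r h m x == Some k) =
  (- r <= x < r) && (k%:R * h - r <= x < k.+1%:R * h - r).
Proof.
move=> h0; rewrite /line_grid; case: ifPn => //= /andP[xr _].
have y0 : 0 <= (x + r) / h by rewrite divr_ge0 ?(ltW h0)//; lra.
transitivity (Num.trunc ((x + r) / h) == k).
  case: insubP => [k' _ vk'|]; first by rewrite -vk'.
  by move=> nlt; apply/esym/negP => /eqP tk; rewrite tk ltn_ord in nlt.
by rewrite truncn_eq// ler_pdivlMr// ltr_pdivrMr// lerBlDr ltrBrDr.
Qed.

Let measurable_line_grid r h m (a : option 'I_m) : 0 < h ->
  measurable [set x | line_grid r h m x = a].
Proof.
move=> h0; have mSome k : measurable [set x | line_grid r h m x = Some k].
  rewrite (_ : [set _ | _] = `[- r, r[ `&` `[k%:R * h - r, k.+1%:R * h - r[).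
    exact: measurableI.
  apply/seteqP; split => x /=; rewrite !in_itv /=.
    by move=> /eqP; rewrite line_grid_fiber// => /andP[].
  by move=> [? ?]; apply/eqP; rewrite line_grid_fiber//; apply/andP.
case: a => [k|]; first exact: mSome.
rewrite (_ : [set _ | _] =
    ~` \big[setU/set0]_(k <- enum 'I_m) [set x | line_grid r h m x = Some k]).
  by apply: measurableC; exact: bigsetU_measurable.
rewrite -bigcup_seq; apply/seteqP; split => x /=.
  by move=> gx [k _ /=]; rewrite gx.
move=> nx; case gx : (line_grid r h m x) => [k|//].
by exfalso; apply: nx; exists k => //=; rewrite mem_enum.
Qed.

Let line_grid_total r h m x : 0 < h -> 2 * r / h <= m%:R ->
  (line_grid r h m x != None) = (- r <= x < r).
Proof.
move=> h0 rm; rewrite /line_grid; case: ifPn => // /andP[xr rx].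
have y0 : 0 <= (x + r) / h by rewrite divr_ge0 ?(ltW h0)//; lra.
case: insubP => // /negP[].
have /andP[tle _] := truncn_itv y0.
rewrite -(ltr_nat R); apply: le_lt_trans tle _; apply: lt_le_trans rm.
by rewrite ltr_pM2r ?invr_gt0//; lra.
Qed.

(** A partition has to cover the whole plane, so the grid of the box is completed by cells having
    [None] in at least one coordinate. These are not small, but they avoid the box. *)
Lemma grid_partition (r h : R) : 0 < h ->
  exists m (A : 'I_m -> set (R * R)) (g : pred 'I_m), [/\ is_partition A,
    forall i, g i -> A i `<=` interval_box r,
    forall i, ~~ g i -> A i `<=` ~` interval_box r &
    forall i, g i -> forall z z', A i z -> A i z' ->
      `|z.1 - z'.1| <= h /\ `|z.2 - z'.2| <= h].
Proof.
move=> h0.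
(* Chosen so that [m] intervals of length [h] starting at [- r] reach [r]. For negative [r] the
   interval is empty and only [0 <= m] is used. *)
set m := (Num.trunc (2 * r / h)).+1.
have rm : 2 * r / h <= m%:R.
  have [y0|/ltW y0] := leP 0 (2 * r / h).
    by have /andP[_ /ltW] := truncn_itv y0.
  exact: le_trans y0 _.
pose J : finType := (option 'I_m * option 'I_m)%type.
pose phi (z : R * R) : J := (line_grid r h m z.1, line_grid r h m z.2).
pose good (j : J) := (j.1 != None) && (j.2 != None).
pose A (i : 'I_#|J|) := [set z | phi z = enum_val i].
exists #|J|, A, (fun i => good (enum_val i)).
have boxE z : good (phi z) <-> interval_box r z.
  by rewrite /good /phi /= !line_grid_total//; split => /andP.
have close k x x' : line_grid r h m x = Some k ->
    line_grid r h m x' = Some k -> `|x - x'| <= h.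
  move=> /eqP + /eqP; rewrite !line_grid_fiber//.
  move=> /andP[_ /andP[a1 a2]] /andP[_ /andP[b1 b2]].
  rewrite ler_norml; move: a2 b2; rewrite -natr1 mulrDl mul1r => a2 b2.
  by apply/andP; split; lra.
split.
- split; [|split].
  + move=> i; rewrite (_ : A i =
        [set x | line_grid r h m x = (enum_val i).1] `*`
        [set x | line_grid r h m x = (enum_val i).2]).
      by apply: measurableX; exact: measurable_line_grid.
    rewrite /A /phi; case: (enum_val i) => a b; apply/seteqP; split => -[x y] /=.
      by case=> -> ->.
    by case=> -> ->.
  + move=> i j ij; apply/seteqP; split => // z [/= zi zj].
    by move/eqP : ij; apply; apply: enum_val_inj; rewrite -zi -zj.
  + by move=> z; exists (enum_rank (phi z)); rewrite /A /= enum_rankK.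
- by move=> i gi z Az; apply/boxE; rewrite Az.
- by move=> i /negP gi z Az; rewrite /setC /= -boxE Az.
- move=> i + [x y] [x' y']; rewrite /A /phi /= /good.
  case: (enum_val i) => -[a|] // [b|] // _ [xa yb] [xa' yb'].
  by split; [exact: close xa xa'|exact: close yb yb'].
Qed.

End Grid.

Section InformationDensity.
Context {R : realType} d (T : measurableType d) (Q : probability T R).

(* With t the mean of L over C, integrate 1 <= e^(t - L) + (L - t). *)
Lemma expRN_jensen (C : set T) (L : T -> R) :
  measurable C -> Q.-integrable C (EFin \o L) ->
  Q.-integrable C (EFin \o (fun w => expR (- L w))) ->
  0 < fine (Q C) ->
  fine (Q C) <= expR ((\int[Q]_(w in C) L w) / fine (Q C)) *
                (\int[Q]_(w in C) expR (- L w)).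
Proof.
move=> mC iL iE p0; set p := fine (Q C); set I := (\int[Q]_(w in C) L w).
set m := (\int[Q]_(w in C) expR (- L w)); set t := I / p.
have icst c : Q.-integrable C (EFin \o (fun=> c)).
  exact: finite_measure_integrable_cst.
have cstE c : (\int[Q]_(w in C) c) = c * p.
  by rewrite /Rintegral integral_cst// fineM// fin_num_measure.
have iM : Q.-integrable C (EFin \o (fun w => expR t * expR (- L w))).
  by have := integrableZl mC (expR t) iE.
have iB : Q.-integrable C (EFin \o (fun w => L w - t)).
  by have := integrableB mC iL (icst t).
have iS : Q.-integrable C (EFin \o (fun w => expR t * expR (- L w) + (L w - t))).
  by have := integrableD mC iM iB.
have : (\int[Q]_(w in C) 1) <=
    (\int[Q]_(w in C) (expR t * expR (- L w) + (L w - t))).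
  apply: le_Rintegral => // w _.
  rewrite -expRD; have := expR_ge1Dx (t - L w); lra.
rewrite RintegralD// RintegralZl// RintegralB// !cstE mul1r -/I -/m.
by rewrite divfK ?gt_eqF// subrr addr0.
Qed.

Context (X Y : T -> R * R).
Hypotheses (mX : measurable_fun setT X) (mY : measurable_fun setT Y).
Variable L : T -> R.
Hypothesis iL : Q.-integrable setT (EFin \o L).
(** Reweighting [Q] by [expR (- L)] makes [X] and [Y] independent with unchanged marginals: [L] is
    the log-density of the joint law against the product of the marginals, tested on rectangles. *)
Hypothesis dens : forall A B, measurable A -> measurable B ->
  (\int[Q]_(w in X @^-1` A `&` Y @^-1` B) (expR (- L w))%:E =
   Q (X @^-1` A) * Q (Y @^-1` B))%E.

Let q A := fine (Q A).

(** Measured in nats, with the default of [mi_part] at [p = 0]; the change to bits is a single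
    division in [mi_partE]. *)
Definition cell_info (p m : R) : R := if p == 0 then 0 else p * ln (p / m).

Lemma mi_partE m1 m2 (A : 'I_m1 -> set (R * R)) (B : 'I_m2 -> set (R * R)) :
  mi_part q X Y A B = (\sum_(i < m1) \sum_(j < m2)
   cell_info (q (X @^-1` A i `&` Y @^-1` B j)) (q (X @^-1` A i) * q (Y @^-1` B j)))
   / ln 2.
Proof.
rewrite /mi_part mulr_suml; apply: eq_bigr => i _.
rewrite mulr_suml; apply: eq_bigr => j _ /=.
by rewrite /cell_info; case: ifP; rewrite ?mul0r// /log2 mulrA.
Qed.

Section Cell.
Variables A B : set (R * R).
Hypotheses (mA : measurable A) (mB : measurable B).
Let C := X @^-1` A `&` Y @^-1` B.
Let p := q C.
Let m := q (X @^-1` A) * q (Y @^-1` B).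

Let mXA : measurable (X @^-1` A).
Proof. by rewrite -[_ @^-1` _]setTI; exact: mX. Qed.
Let mYB : measurable (Y @^-1` B).
Proof. by rewrite -[_ @^-1` _]setTI; exact: mY. Qed.
Lemma measurable_cell : measurable C. Proof. exact: measurableI. Qed.
Let mC := measurable_cell.

Lemma cell_mass : (\int[Q]_(w in C) (expR (- L w))%:E)%E = m%:E.
Proof. by rewrite dens// EFinM !fineK// fin_num_measure. Qed.

Lemma cell_massR : (\int[Q]_(w in C) expR (- L w)) = m.
Proof. by rewrite /Rintegral cell_mass. Qed.

Let iLC : Q.-integrable C (EFin \o L).
Proof. exact: integrableS iL. Qed.

Let iEC : Q.-integrable C (EFin \o (fun w => expR (- L w))).
Proof.
apply/integrableP; split.
  apply/measurable_EFinP; apply: measurableT_comp => //.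
  apply: measurableT_comp => //.
  by move/measurable_int : iLC => /measurable_EFinP.
under eq_integral do rewrite /= ger0_norm ?expR_ge0//.
by rewrite cell_mass ltry.
Qed.

Let p_ge0 : 0 <= p. Proof. exact: fine_ge0. Qed.
Let m_ge0 : 0 <= m. Proof. by rewrite mulr_ge0// fine_ge0. Qed.

Let int_null c : p = 0 -> (\int[Q]_(w in C) (L w - c)) = 0.
Proof.
move=> p0; have QC0 : Q C = 0%E.
  by rewrite -[LHS](@fineK _ (Q C)) ?fin_num_measure// -/(q C) -/p p0.
rewrite /Rintegral null_set_integral//.
apply/measurable_EFinP; apply: measurable_funB => //.
by move/measurable_int : iLC => /measurable_EFinP.
Qed.

Let int_sub c : (\int[Q]_(w in C) (L w - c)) = (\int[Q]_(w in C) L w) - c * p.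
Proof.
rewrite RintegralB//; last exact: finite_measure_integrable_cst.
by rewrite [X in _ - X]/Rintegral integral_cst// fineM// fin_num_measure.
Qed.

(** Absolute continuity: Jensen bounds [p] by a finite multiple of [m]. *)
Lemma cell_mass_gt0 : 0 < p -> 0 < m.
Proof.
move=> p0; rewrite lt_neqAle m_ge0 andbT; apply/eqP => m0.
have := expRN_jensen mC iLC iEC p0.
by rewrite cell_massR -m0 mulr0 leNgt p0.
Qed.

(** With [t] the mean of [L] over the cell, Jensen reads [p <= expR t * m], that is,
    [ln (p / m) <= t]; multiplying by [p] gives the integral. *)
Lemma cell_info_le : cell_info p m <= \int[Q]_(w in C) L w.
Proof.
rewrite /cell_info; case: ifPn => [/eqP p0|pn0].
  have := int_null 0 p0; rewrite int_sub mul0r subr0; lra.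
have p0 : 0 < p by rewrite lt_neqAle eq_sym pn0.
have m0 := cell_mass_gt0 p0.
have := expRN_jensen mC iLC iEC p0.
rewrite cell_massR -ler_pdivrMr// => h.
rewrite mulrC -ler_pdivlMr// -ler_expR lnK//.
by rewrite posrE divr_gt0.
Qed.

(** This is [1 + ln x <= x] at [x = m / p]. It ignores the variation of [L], hence serves on the
    unbounded cells. *)
Lemma cell_info_ge_mass : p - m <= cell_info p m.
Proof.
rewrite /cell_info; case: ifPn => [/eqP ->|pn0].
  by rewrite sub0r oppr_le0.
have p0 : 0 < p by rewrite lt_neqAle eq_sym pn0.
have m0 := cell_mass_gt0 p0.
have := expR_ge1Dx (ln (m / p)); rewrite lnK ?posrE ?divr_gt0// => h.
rewrite -[p / m]invf_div lnV ?posrE ?divr_gt0// mulrN.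
have : p * (1 + ln (m / p)) <= p * (m / p) by rewrite ler_pM2l.
by rewrite [p * (m / p)]mulrC divfK ?gt_eqF//; lra.
Qed.

Lemma cell_info_ge e : (forall w w', C w -> C w' -> L w <= L w' + e) ->
  \int[Q]_(w in C) (L w - e) <= cell_info p m.
Proof.
move=> Le; rewrite /cell_info; case: ifPn => [/eqP p0|pn0].
  by rewrite int_null.
have p0 : 0 < p by rewrite lt_neqAle eq_sym pn0.
have m0 := cell_mass_gt0 p0.
(* Fix [w]. Since [L w - e] is a lower bound of [L] on the cell, integrating [expR (- L)] there
   gives [m <= p * expR (- (L w - e))]. *)
have key w : C w -> L w - e <= ln (p / m).
  move=> Cw; rewrite -ler_expR lnK ?posrE ?divr_gt0// ler_pdivlMr//.
  have : (\int[Q]_(w in C) expR (- L w)) <= (\int[Q]_(x in C) expR (- (L w - e))).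
    apply: le_Rintegral => //; first exact: finite_measure_integrable_cst.
    by move=> w' Cw'; rewrite ler_expR lerN2; have := Le _ _ Cw Cw'; lra.
  rewrite [leRHS]/Rintegral integral_cst// fineM// ?fin_num_measure//.
  rewrite cell_massR /= -/(q C) -/p expRN => h.
  by rewrite mulrC -ler_pdivlMr ?expR_gt0// mulrC.
rewrite [leRHS](_ : _ = (\int[Q]_(w in C) ln (p / m))); last first.
  by rewrite [RHS]/Rintegral integral_cst// fineM ?fin_num_measure// mulrC.
apply: le_Rintegral => //; last exact: finite_measure_integrable_cst.
exact: (integrableB mC iLC (finite_measure_integrable_cst Q e mC)).
Qed.

End Cell.

Lemma Rintegral_finpart (I : finType) (g : pred I) (C : I -> set T) (D : set T)
    (f : T -> R) :
  (forall i, measurable (C i)) ->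
  (forall i j, i != j -> C i `&` C j = set0) ->
  (forall w, D w <-> exists2 i, g i & C i w) ->
  Q.-integrable setT (EFin \o f) ->
  \int[Q]_(w in D) f w = \sum_(i | g i) \int[Q]_(w in C i) f w.
Proof.
move=> mC tC DE intf.
have DU : D = \big[setU/set0]_(i <- enum g) C i.
  apply/seteqP; split => w; rewrite -bigcup_seq /bigcup /=.
    by case/DE => i gi Ci; exists i; rewrite ?mem_enum.
  by move=> [i]; rewrite mem_enum => gi Ci; apply/DE; exists i.
rewrite [LHS]/Rintegral DU integral_bigsetU_EFin ?enum_uniq//; first last.
- by apply/measurable_funTS; move/measurable_int : intf.
- move=> i j _ _ [w Cw]; apply/eqP; apply: contraPT Cw => /tC ->.
  by case.
have fi i : (\int[Q]_(w in C i) (f w)%:E)%E \is a fin_num.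
  by apply: integrable_fin_num => //; apply: integrableS intf.
rewrite -sum_fine; last by move=> i _; exact: fi.
by rewrite big_enum.
Qed.

Section Partitions.
Variables (m1 m2 : nat) (A : 'I_m1 -> set (R * R)) (B : 'I_m2 -> set (R * R)).
Hypotheses (pA : is_partition A) (pB : is_partition B).
Let C (ij : 'I_m1 * 'I_m2) := X @^-1` A ij.1 `&` Y @^-1` B ij.2.

Let mC ij : measurable (C ij).
Proof. by case: pA => ? _; case: pB => ? _; exact: measurable_cell. Qed.

Let tC ij ij' : ij != ij' -> C ij `&` C ij' = set0.
Proof.
move: ij ij' => [i j] [i' j'] neq; apply/seteqP; split => // w /= [[Ai Bj] [Ai' Bj']].
case: pA => _ [tA _]; case: pB => _ [tB _].
have [ii|/tA h] := eqVneq i i'; last first.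
  by have : (A i `&` A i') (X w) by []; rewrite h.
have [jj|/tB h] := eqVneq j j'; last first.
  by have : (B j `&` B j') (Y w) by []; rewrite h.
by rewrite ii jj eqxx in neq.
Qed.

Let cell (ij : 'I_m1 * 'I_m2) :=
  cell_info (q (C ij)) (q (X @^-1` A ij.1) * q (Y @^-1` B ij.2)).

Let mi_partE2 : mi_part q X Y A B = (\sum_ij cell ij) / ln 2.
Proof. by rewrite mi_partE pair_big. Qed.

Let ln2_gt0 : 0 < ln 2 :> R.
Proof. by rewrite ln_gt0// ltr1n. Qed.

Lemma mi_part_le : mi_part q X Y A B <= (\int[Q]_w L w) / ln 2.
Proof.
rewrite mi_partE2 ler_pM2r ?invr_gt0// (@Rintegral_finpart _ xpredT C)//.
  by apply: ler_sum => -[i j] _; apply: cell_info_le; [case: pA|case: pB].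
move=> w; split=> // _.
case: pA => _ [_ /(_ (X w))[i Ai]]; case: pB => _ [_ /(_ (Y w))[j Bj]].
by exists (i, j).
Qed.

Section Good.
Variables (gA : pred 'I_m1) (gB : pred 'I_m2) (box : set (R * R)) (e : R).
Hypotheses (gAin : forall i, gA i -> A i `<=` box)
           (gAout : forall i, ~~ gA i -> A i `<=` ~` box)
           (gBin : forall i, gB i -> B i `<=` box)
           (gBout : forall i, ~~ gB i -> B i `<=` ~` box).
Hypothesis (e0 : 0 <= e).
Hypothesis osc : forall i j, gA i -> gB j ->
  forall w w', C (i, j) w -> C (i, j) w' -> L w <= L w' + e.
Let Gd := X @^-1` box `&` Y @^-1` box.

(** The preimage of the box is the disjoint union of the preimages of the good cells, which also
    yields its measurability. *)
Let box_mass m (F : 'I_m -> set (R * R)) (g : pred 'I_m) (Z : T -> R * R) :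
  measurable_fun setT Z -> is_partition F ->
  (forall i, g i -> F i `<=` box) -> (forall i, ~~ g i -> F i `<=` ~` box) ->
  (q (Z @^-1` box) = \sum_(i | g i) q (Z @^-1` F i)) *
  (1 = \sum_i q (Z @^-1` F i)).
Proof.
move=> mZ [mF [tF cF]] gin gout.
have mZF i : measurable (Z @^-1` F i).
  by rewrite -[_ @^-1` _]setTI; exact: mZ.
have tZF i j : i != j -> (Z @^-1` F i) `&` (Z @^-1` F j) = set0.
  by move=> /tF FF; rewrite -preimage_setI FF preimage_set0.
have i1 : Q.-integrable setT (EFin \o (fun=> 1)).
  exact: finite_measure_integrable_cst.
have qE (D : set T) : measurable D -> \int[Q]_(w in D) 1 = q D.
  by move=> mD; rewrite /Rintegral integral_cst// mul1e.
have boxE w : (Z @^-1` box) w <-> exists2 i, g i & (Z @^-1` F i) w.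
  split=> [bw|[i gi Fi]]; last exact: gin Fi.
  have [i Fi] := cF (Z w); exists i => //.
  by apply/negPn/negP => /gout /(_ _ Fi).
have mbox : measurable (Z @^-1` box).
  rewrite (_ : _ @^-1` _ = \big[setU/set0]_(i <- enum g) (Z @^-1` F i)).
    exact: bigsetU_measurable.
  apply/seteqP; split => w; rewrite -bigcup_seq /bigcup /=.
    by case/boxE => i gi Ci; exists i; rewrite ?mem_enum.
  by move=> [i]; rewrite mem_enum => gi Ci; apply/boxE; exists i.
split.
  rewrite -qE// (Rintegral_finpart mZF tZF boxE i1).
  by apply: eq_bigr => i _; rewrite qE.
rewrite -[LHS](_ : \int[Q]_w 1 = 1); last by rewrite qE// /q probability_setT.
rewrite (@Rintegral_finpart _ xpredT (fun i => Z @^-1` F i))//.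
  by apply: eq_bigr => i _; rewrite qE.
by move=> w; split=> // _; have [i Fi] := cF (Z w); exists i.
Qed.

Lemma mi_part_ge :
  (\int[Q]_(w in Gd) L w - e - (1 - q (X @^-1` box) * q (Y @^-1` box))) / ln 2
  <= mi_part q X Y A B.
Proof.
rewrite mi_partE2 ler_pM2r ?invr_gt0//.
pose g (ij : 'I_m1 * 'I_m2) := gA ij.1 && gB ij.2.
have [qX oneX] := box_mass mX pA gAin gAout.
have [qY oneY] := box_mass mY pB gBin gBout.
pose mm (ij : 'I_m1 * 'I_m2) := q (X @^-1` A ij.1) * q (Y @^-1` B ij.2).
have mmT : \sum_ij mm ij = 1.
  rewrite -[RHS]mulr1 {1}oneX oneY mulr_suml -(pair_bigA _ (fun i j => mm (i, j))) /=.
  by apply: eq_bigr => i _; rewrite mulr_sumr.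
have mmG : \sum_(ij | g ij) mm ij = q (X @^-1` box) * q (Y @^-1` box).
  rewrite qX qY mulr_suml -(pair_big _ _ (fun i j => mm (i, j))) /=.
  by apply: eq_bigr => i _; rewrite mulr_sumr.
have iLe : Q.-integrable setT (EFin \o (fun w => L w - e)).
  apply: (integrableB _ iL (finite_measure_integrable_cst Q e _)) => //.
have GdE w : Gd w <-> exists2 ij, g ij & C ij w.
  split=> [[bX bY]|[[i j] /andP[/= gi gj] [/= Ai Bj]]]; last first.
    by split; [exact: gAin Ai|exact: gBin Bj].
  case: pA => _ [_ /(_ (X w))[i Ai]]; case: pB => _ [_ /(_ (Y w))[j Bj]].
  exists (i, j) => //; apply/andP; split => /=.
    by apply/negPn/negP => /gAout /(_ _ Ai).
  by apply/negPn/negP => /gBout /(_ _ Bj).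
have mGd : measurable Gd.
  rewrite (_ : Gd = \big[setU/set0]_(i <- enum g) C i).
    exact: bigsetU_measurable.
  apply/seteqP; split => w; rewrite -bigcup_seq /bigcup /=.
    by case/GdE => i gi Ci; exists i; rewrite ?mem_enum.
  by move=> [i]; rewrite mem_enum => gi Ci; apply/GdE; exists i.
have iLG : Q.-integrable Gd (EFin \o L) by exact: integrableS iL.
(* On good cells the oscillation bound applies; on the others [p - m] is weakened to [- m], and
   these [m] add up to one minus the product mass of the good cells. *)
have : (\int[Q]_(w in Gd) (L w - e)) - \sum_(ij | ~~ g ij) mm ij <= \sum_ij cell ij.
  rewrite [leRHS](bigID g) /= (Rintegral_finpart mC tC GdE iLe).
  rewrite -sumrN; apply: lerD; apply: ler_sum => -[i j].
    move=> /andP[/= gi gj]; apply: cell_info_ge; [by case: pA|by case: pB|].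
    exact: osc.
  move=> _; apply: le_trans (cell_info_ge_mass _ _); [|by case: pA|by case: pB].
  by rewrite lerDr fine_ge0.
apply: le_trans; rewrite RintegralB//; last exact: finite_measure_integrable_cst.
rewrite [X in _ <= _ - X - _]/Rintegral integral_cst//.
rewrite fineM ?fin_num_measure//= -/(q Gd).
have : q Gd <= 1 by rewrite -[leRHS]/(fine 1%E) fine_le ?fin_num_measure ?probability_le1.
have : 1 = q (X @^-1` box) * q (Y @^-1` box) + \sum_(ij | ~~ g ij) mm ij.
  by rewrite -mmG -mmT (bigID g).
move: (\sum_(_ | _) _) => s2 one qG1.
have : 0 <= e * (1 - q Gd) by rewrite mulr_ge0// subr_ge0.
move: one; rewrite mulrBr mulr1; lra.
Qed.
End Good.
End Partitions.

End InformationDensity.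

(** * Passage to the limit over growing boxes *)

Section MutualInformationDensity.
Context {R : realType} d (T : measurableType d) (Q : probability T R).

Lemma cvg_Rintegral_exhaustion (F : nat -> set T) (f : T -> R) :
  (forall n, measurable (F n)) -> (forall w, \forall n \near \oo, F n w) ->
  Q.-integrable setT (EFin \o f) ->
  \int[Q]_(w in F n) f w @[n --> \oo] --> \int[Q]_w f w.
Proof.
move=> mF FT intf.
have mf : measurable_fun setT (EFin \o f) by move/measurable_int : intf.
pose g n := (EFin \o f) \_ (F n).
have mg n : measurable_fun setT (g n).
  by apply/(measurable_restrictT _ (mF n)).1/measurable_funTS.
have gf w : [set: T] w -> g n w @[n --> \oo] --> (f w)%:E.
  move=> _; apply: cvg_near_cst; near=> n; rewrite /g patchE mem_set//.
  by near: n; exact: FT.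
have gle w n : [set: T] w -> (`|g n w| <= `|(f w)%:E|)%E.
  by move=> _; rewrite /g patchE; case: ifPn => // _; rewrite abse0.
have [_ _] := dominated_convergence measurableT mg mf (aeW Q gf)
  (integrable_abse intf) (aeW Q gle).
have finT : (\int[Q]_w (f w)%:E)%E \is a fin_num by exact: integrable_fin_num.
move=> h; apply/fine_cvg; rewrite fineK//.
by under eq_fun do rewrite integral_mkcond.
Unshelve. all: end_near. Qed.

(** Jensen bounds every partition from above; grids on growing boxes reach the mean of [l] from
    below. The last hypothesis is uniform continuity on boxes, and its one-sided form suffices since
    the two points may be exchanged. *)
Lemma mutual_info_density (X Y : T -> R * R) (l : R * R -> R * R -> R) :
  measurable_fun setT X -> measurable_fun setT Y ->
  Q.-integrable setT (EFin \o (fun w => l (X w) (Y w))) ->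
  (forall A B, measurable A -> measurable B ->
    (\int[Q]_(w in X @^-1` A `&` Y @^-1` B) (expR (- l (X w) (Y w)))%:E =
     Q (X @^-1` A) * Q (Y @^-1` B))%E) ->
  (forall r e, 0 < e -> exists2 h, 0 < h & forall x x' y y',
    interval_box r x -> interval_box r x' ->
    interval_box r y -> interval_box r y' ->
    `|x.1 - x'.1| <= h -> `|x.2 - x'.2| <= h ->
    `|y.1 - y'.1| <= h -> `|y.2 - y'.2| <= h -> l x y <= l x' y' + e) ->
  mutual_info (fun A => fine (Q A)) X Y =
    ((\int[Q]_w l (X w) (Y w)) / ln 2)%:E.
Proof.
move=> mX mY iL dens unif; set L := fun w => l (X w) (Y w).
apply/eqP; rewrite eq_le; apply/andP; split.
  apply: ge_ereal_sup => _ [m1 [m2 [A [B [pA pB ->]]]]].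
  by rewrite lee_fin; exact: mi_part_le.
pose Gd n := X @^-1` (interval_box n%:R) `&` Y @^-1` (interval_box n%:R).
(* The bound of [mi_part_ge] for the box of half-side [n] and tolerance [1 / (n + 1)]. The boxes
   exhaust the plane, so the last bracket tends to [1 - 1 * 1] and only the mean of [L] is left. *)
pose u n := (\int[Q]_(w in Gd n) L w - n.+1%:R^-1 -
  (1 - fine (Q (X @^-1` (interval_box n%:R))) *
       fine (Q (Y @^-1` (interval_box n%:R))))) / ln 2.
have u_le n : ((u n)%:E <= mutual_info (fun A => fine (Q A)) X Y)%E.
  have e0 : 0 < n.+1%:R^-1 :> R by rewrite invr_gt0.
  have [h h0 hl] := unif n%:R _ e0.
  have [m [A [g [pA gin gout gh]]]] := grid_partition n%:R h0.
  have osc : forall i j, g i -> g j -> forall w w', (X @^-1` A i `&` Y @^-1` A j) w ->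
      (X @^-1` A i `&` Y @^-1` A j) w' -> L w <= L w' + n.+1%:R^-1.
    move=> i j gi gj w w' [/= Xi Yj] [/= Xi' Yj'].
    have [x1 x2] := gh i gi _ _ Xi Xi'; have [y1 y2] := gh j gj _ _ Yj Yj'.
    by apply: hl => //; [exact: gin Xi|exact: gin Xi'|exact: gin Yj|exact: gin Yj'].
  have := mi_part_ge mX mY iL dens pA pA gin gout gin gout (ltW e0) osc.
  rewrite -lee_fin => /le_trans; apply; apply: ereal_sup_ubound.
  by exists m, m, A, A.
have mbox r : measurable (@interval_box R r).
  rewrite (_ : interval_box r = `[- r, r[ `*` `[- r, r[).
    exact: measurableX.
  by apply/seteqP; split => z /=; rewrite !in_itv.
have nbox (z : R * R) : \forall n \near \oo, interval_box n%:R z.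
  near=> n; have /andP[]: (`|z.1| < n%:R) && (`|z.2| < n%:R).
    by apply/andP; split; near: n; exact: nbhs_infty_gtr.
  rewrite !ltr_norml => /andP[/ltW a1 a2] /andP[/ltW b1 b2].
  by split; apply/andP.
have cvgq (Z : T -> R * R) : measurable_fun setT Z ->
    fine (Q (Z @^-1` (interval_box n%:R))) @[n --> \oo] --> (1 : R).
  move=> mZ.
  have mZb n : measurable (Z @^-1` (interval_box n%:R)).
    by rewrite -[_ @^-1` _]setTI; exact: mZ.
  have qE (D : set T) : measurable D -> fine (Q D) = \int[Q]_(w in D) 1.
    by move=> mD; rewrite /Rintegral integral_cst// mul1e.
  have := cvg_Rintegral_exhaustion mZb (fun w => nbox (Z w))
    (finite_measure_integrable_cst Q 1 measurableT).
  by rewrite -(qE setT)// probability_setT; under eq_fun do rewrite -qE//.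
have cvgu : u n @[n --> \oo] --> (\int[Q]_w L w) / ln 2.
  have -> : (\int[Q]_w L w) / ln 2 = (\int[Q]_w L w - 0 - (1 - 1 * 1)) / ln 2.
    by rewrite mul1r subrr !subr0.
  apply: cvgMl; apply: cvgB; first apply: cvgB.
    - apply: cvg_Rintegral_exhaustion => //.
        by move=> n; apply: measurableI; rewrite -[_ @^-1` _]setTI;
          [exact: mX|exact: mY].
      move=> w; near=> n; split; [near: n; exact: nbox|near: n; exact: nbox].
    - exact: cvg_harmonic.
    - by apply: cvgB; [exact: cvg_cst|apply: cvgM; exact: cvgq].
rewrite -(cvg_lim _ cvgu)// -EFin_lim; last by apply/cvg_ex; eexists; exact: cvgu.
apply: lime_le; last by near=> n; exact: u_le.
by apply/cvg_ex; eexists; apply: cvg_EFin; [near=> n|exact: cvgu].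
Unshelve. all: end_near. Qed.

End MutualInformationDensity.

(** * Gaussian integrals *)

Section NormalIntegrals.
Context {R : realType}.
Local Notation mu := (@lebesgue_measure R).

(** The image of Lebesgue measure under the shift agrees with it on half-open intervals, which
    determine it. *)
Lemma ge0_integral_lebesgue_shift (c : R) (f : R -> \bar R) :
  measurable_fun setT f -> (forall x, 0 <= f x)%E ->
  (\int[mu]_x f (x + c)%R = \int[mu]_x f x)%E.
Proof.
move=> mf f0.
pose phi : measurableTypeR R -> measurableTypeR R := fun x => x + c.
have mphi : measurable_fun setT phi by exact: measurable_funD.
rewrite -[LHS](@ge0_integral_pushforward _ _ _ _ _ phi mphi mu setT f)//.
apply: eq_measure_integral => A mA _; apply/esym/lebesgue_measure_unique => //.
move=> _ [[a b] _ <-]; rewrite /= /pushforward.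
rewrite (_ : phi @^-1` _ = `]a - c, b - c]%classic); last first.
  by apply/seteqP; split => x /=; rewrite !in_itv /phi /= ltrBlDr lerBrDr.
rewrite !lebesgue_measure_itv /= !lte_fin ltrD2r; case: ifP => // _.
by rewrite -!EFinB; congr EFin; ring.
Qed.

(** The Radon-Nikodym derivative of [normal_prob] and [normal_pdf] have the same integral over every
    measurable set, so they agree almost everywhere and may be exchanged under the integral. *)
Lemma ge0_integral_normal_prob (m s : R) (f : R -> \bar R) :
  measurable_fun setT f -> (forall x, 0 <= f x)%E ->
  (\int[normal_prob m s]_x f x = \int[mu]_x (f x * (normal_pdf m s x)%:E))%E.
Proof.
move=> mf f0; have dom := normal_prob_dominates m s.
rewrite -(Radon_Nikodym_SigmaFinite.change_of_variables dom)//.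
have iRN := Radon_Nikodym_SigmaFinite.f_integrable dom.
have mpdf : measurable_fun setT (EFin \o normal_pdf m s).
  by apply/measurable_EFinP; exact: measurable_normal_pdf.
apply: ge0_ae_eq_integral => //.
- by apply: emeasurable_funM => //; exact: measurable_int iRN.
- exact: emeasurable_funM.
- by move=> x _; rewrite mule_ge0// Radon_Nikodym_SigmaFinite.f_ge0.
- by move=> x _; rewrite mule_ge0// lee_fin normal_pdf_ge0.
- apply: ae_eqe_mul2l; apply: integral_ae_eq => // A _ mA.
  by rewrite -Radon_Nikodym_SigmaFinite.f_integral.
Qed.

Lemma normal_pdf0E (m s x : R) : 0 < s ->
  normal_pdf m s x = (Num.sqrt (pi *+ 2) * s)^-1 * expR (- (x - m) ^+ 2 / (s ^+ 2 *+ 2)).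
Proof.
move=> s0; rewrite normal_pdfE ?gt_eqF// /normal_peak; congr (_^-1 * _).
by rewrite -mulrnAr sqrtrM ?sqr_ge0// sqrtr_sqr gtr0_norm// mulrC.
Qed.

(** Completing the square in [x]. The second factor on the right is the conditional density of the
    first summand given the sum [y]; it integrates to 1 in [x], leaving the density of the sum. *)
Lemma normal_pdf_mul (s t x y : R) : 0 < s -> 0 < t ->
  let u := Num.sqrt (s ^+ 2 + t ^+ 2) in
  normal_pdf 0 s x * normal_pdf 0 t (y - x) =
  normal_pdf 0 u y * normal_pdf (y * s ^+ 2 / u ^+ 2) (s * t / u) x.
Proof.
move=> s0 t0 u.
have w0 : 0 < s ^+ 2 + t ^+ 2 by rewrite addr_gt0 ?exprn_gt0.
have u0 : 0 < u by rewrite sqrtr_gt0.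
have uE : u ^+ 2 = s ^+ 2 + t ^+ 2 by rewrite sqr_sqrtr// ltW.
rewrite !normal_pdf0E ?divr_gt0 ?mulr_gt0//.
have p0 : Num.sqrt (pi *+ 2) != 0 :> R.
  by rewrite gt_eqF// sqrtr_gt0 mulrn_wgt0// pi_gt0.
rewrite mulrACA [RHS]mulrACA -!expRD; congr (_ * expR _).
  by field; rewrite p0 !gt_eqF.
rewrite !subr0 expr_div_n exprMn uE.
have a0 : 0 < s ^+ 2 by rewrite exprn_gt0.
have b0 : 0 < t ^+ 2 by rewrite exprn_gt0.
move: (s ^+ 2) (t ^+ 2) w0 a0 b0 => a b w0 a0 b0.
by field; rewrite !gt_eqF.
Qed.

(* ln (p (y - x) / p' y) for p, p' the densities of N(0, t^2), N(0, u^2): the information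
   density of a Gaussian channel with noise of deviation t and output of deviation u. *)
Definition normal_llr (t u x y : R) : R :=
  ln (u / t) - (y - x) ^+ 2 / (t ^+ 2 *+ 2) + y ^+ 2 / (u ^+ 2 *+ 2).

Lemma expRN_normal_llr (t u x y : R) : 0 < t -> 0 < u ->
  expR (- normal_llr t u x y) * normal_pdf 0 t (y - x) = normal_pdf 0 u y.
Proof.
move=> t0 u0; rewrite !normal_pdf0E// mulrCA -expRD !subr0.
rewrite [X in expR X](_ : _ = - ln (u / t) + - y ^+ 2 / (u ^+ 2 *+ 2)); last first.
  by rewrite /normal_llr; ring.
rewrite expRD expRN lnK ?posrE ?divr_gt0// mulrA; congr (_ * _).
have p0 : Num.sqrt (pi *+ 2) != 0 :> R.
  by rewrite gt_eqF// sqrtr_gt0 mulrn_wgt0// pi_gt0.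
by field; rewrite p0 !gt_eqF.
Qed.

Lemma measurable_normal_llr d (T : measurableType d) t u (p q : T -> R) :
  measurable_fun setT p -> measurable_fun setT q ->
  measurable_fun setT (fun w => normal_llr t u (p w) (q w)).
Proof.
move=> mp mq; apply: measurable_funD.
  apply: measurable_funB => //; apply: measurable_funM => //.
  by apply: measurable_funX; exact: measurable_funB.
by apply: measurable_funM => //; exact: measurable_funX.
Qed.

(** The density identity for one real coordinate and a fixed input [x]: after the shift [y = x + g],
    the weight turns the noise density into the output density. *)
Lemma integral_normal_llr_kernel (t u x : R) (f : R -> \bar R) :
  0 < t -> 0 < u -> measurable_fun setT f -> (forall y, 0 <= f y)%E ->
  (\int[normal_prob 0 t]_g (f (x + g)%R * (expR (- normal_llr t u x (x + g)))%:E)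
   = \int[normal_prob 0 u]_y f y)%E.
Proof.
move=> t0 u0 mf f0.
have mxg : measurable_fun setT (fun g : R => x + g) by exact: measurable_funD.
pose F g : \bar R := (f (x + g)%R * (expR (- normal_llr t u x (x + g)))%:E)%E.
have mF : measurable_fun setT F.
  apply: emeasurable_funM; first exact: measurableT_comp.
  apply/measurable_EFinP; apply: measurableT_comp => //; apply: measurableT_comp => //.
  exact: measurable_normal_llr.
have F0 g : (0 <= F g)%E by rewrite mule_ge0// lee_fin expR_ge0.
rewrite (ge0_integral_normal_prob 0 t mF F0) (ge0_integral_normal_prob 0 u mf f0).
pose G y : \bar R := (f y * (normal_pdf 0 u y)%:E)%E.
have mG : measurable_fun setT G.
  by apply: emeasurable_funM => //; apply/measurable_EFinP; exact: measurable_normal_pdf.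
have G0 y : (0 <= G y)%E by rewrite mule_ge0// lee_fin normal_pdf_ge0.
rewrite -(ge0_integral_lebesgue_shift x mG G0).
apply: eq_integral => g _; rewrite /F /G (addrC g) -muleA -EFinM.
have -> : normal_pdf 0 t g = normal_pdf 0 t ((x + g) - x) by rewrite addrC addKr.
by rewrite expRN_normal_llr.
Qed.

Lemma normal_prob_add (s t : R) (A : set R) : 0 < s -> 0 < t -> measurable A ->
  ((normal_prob 0 s \x normal_prob 0 t)%E [set z | A (z.1 + z.2)] =
   normal_prob 0 (Num.sqrt (s ^+ 2 + t ^+ 2)) A).
Proof.
move=> s0 t0 mA; set u := Num.sqrt _.
(* The coordinates are the first summand and the sum. Integrating the sum first gives the product
   law, integrating the summand first gives the normal law of the sum; Tonelli equates the two. *)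
pose f (z : R * R) : \bar R := (\1_A z.2 * (normal_pdf 0 s z.1 * normal_pdf 0 t (z.2 - z.1)))%:E.
have mindA : measurable_fun setT (\1_A : R -> R) by exact: measurable_indic.
have mpdf (m r : R) : measurable_fun setT (normal_pdf m r) by exact: measurable_normal_pdf.
have mpdfE (m r : R) : measurable_fun setT (EFin \o normal_pdf m r).
  exact/measurable_EFinP.
have mf : measurable_fun setT f.
  apply/measurable_EFinP; apply: measurable_funM; first exact: measurableT_comp.
  apply: measurable_funM; first exact: measurableT_comp.
  by apply: measurableT_comp => //; exact: measurable_funB.
have f0 z : (0 <= f z)%E.
  by rewrite lee_fin !mulr_ge0 ?normal_pdf_ge0.
transitivity (\int[mu]_x \int[mu]_y f (x, y))%E; last first.
  rewrite (@fubini_tonelli _ _ _ _ R mu mu f mf f0).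
  rewrite /normal_prob [RHS]integral_mkcond; apply: eq_integral => y _.
  rewrite /fubini_G /f /=.
  under eq_integral => x _ do rewrite normal_pdf_mul// mulrA EFinM.
  rewrite ge0_integralZl//; first last.
  - by rewrite lee_fin mulr_ge0// normal_pdf_ge0.
  - by move=> x _; rewrite lee_fin normal_pdf_ge0.
  - exact: mpdfE.
  rewrite integral_normal_pdf mule1 patchE indicE.
  by case: ifPn => yA; rewrite ?mul1r ?mul0r.
have mxsec : measurable [set z : R * R | A (z.1 + z.2)].
  rewrite -[X in measurable X]setTI.
  by apply: (measurable_funD measurable_fst measurable_snd) => //.
pose m2 x := normal_prob 0 t (xsection [set z : R * R | A (z.1 + z.2)] x).
have mm2 : measurable_fun setT m2 by exact: measurable_fun_xsection.
have m20 x : (0 <= m2 x)%E by [].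
rewrite -[LHS]/(\int[normal_prob 0 s]_x m2 x)%E.
rewrite (ge0_integral_normal_prob 0 s mm2 m20).
apply: eq_integral => x _; rewrite /m2.
pose g y := (f (x, y)).
have mg : measurable_fun setT g by exact: measurableT_comp.
have g0 y : (0 <= g y)%E by exact: f0.
rewrite -[RHS](ge0_integral_lebesgue_shift x mg g0).
rewrite /normal_prob integral_mkcond muleC -ge0_integralZl//; first last.
- by rewrite lee_fin normal_pdf_ge0.
- by move=> y _; apply: erestrict_ge0 => z _; rewrite lee_fin normal_pdf_ge0.
- apply/(measurable_restrictT _ _).1; first exact: measurable_xsection.
  exact: measurable_funTS (mpdfE 0 t).
apply: eq_integral => y _; rewrite /g /f /= addrK patchE indicE mem_xsection.
have -> : ((x, y) \in [set z : R * R | A (z.1 + z.2)]) = (y + x \in A).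
  by apply/idP/idP; rewrite !inE /= addrC.
by case: ifPn => _; rewrite ?mul1r ?mul0r ?mule0// EFinM.
Qed.
End NormalIntegrals.

(** * Independence beyond rectangles and sums of independent Gaussians *)

Section ProductLaw.
Context {R : realType} d (T : measurableType d) (Q : probability T R).

(** If [D] is null both sides vanish. Otherwise the image of [Q] restricted to [D] and divided by
    [Q D] agrees with the product measure on rectangles, hence everywhere by uniqueness. Keeping [D]
    in the statement lets the lemma be iterated, the variables not yet merged being recorded in
    [D]. *)
Lemma product_law d1 d2 (T1 : measurableType d1) (T2 : measurableType d2)
    (m1 : {sigma_finite_measure set T1 -> \bar R})
    (m2 : {sigma_finite_measure set T2 -> \bar R})
    (U : T -> T1) (V : T -> T2) (D : set T) :
  measurable D -> measurable_fun setT U -> measurable_fun setT V ->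
  (forall A B, measurable A -> measurable B ->
    Q (D `&` (U @^-1` A `&` V @^-1` B)) = (Q D * (m1 A * m2 B))%E) ->
  forall C, measurable C ->
    Q (D `&` (fun w => (U w, V w)) @^-1` C) = (Q D * (m1 \x m2)%E C)%E.
Proof.
move=> mD mU mV QE C mC.
have mW : measurable_fun setT (fun w => (U w, V w)) by exact: measurable_fun_pair.
have mWC : measurable ((fun w => (U w, V w)) @^-1` C).
  by rewrite -[_ @^-1` _]setTI; exact: mW.
have [QD0|QD0] := eqVneq (Q D) 0%E.
  rewrite QD0 mul0e; apply/eqP; rewrite eq_le measure_ge0 andbT -QD0.
  by apply: le_measure; rewrite ?inE//; exact: measurableI.
have QDfin : Q D \is a fin_num by exact: fin_num_measure.
have c_gt0 : 0 < fine (Q D).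
  by rewrite fine_gt0// lt_neqAle eq_sym QD0 measure_ge0 -ge0_fin_numE.
pose c : {nonneg R} := NngNum (ltW (eqbRL (invr_gt0 (fine (Q D))) c_gt0)).
pose m' := mscale c (pushforward (mrestr Q mD) (fun w => (U w, V w))).
have -> : Q (D `&` (fun w => (U w, V w)) @^-1` C) = (Q D * m' mW C)%E.
  rewrite -[m' mW C]/(c%:num%:E * Q ((fun w => (U w, V w)) @^-1` C `&` D))%E.
  rewrite setIC muleA.
  by rewrite -{1}(fineK QDfin) -EFinM divff ?mul1e// gt_eqF.
congr (_ * _)%E; symmetry; apply: (@product_measure_unique _ _ _ _ _ m1 m2 
  (mscale c (pushforward (mrestr Q mD) (fun w => (U w, V w))))) => // A B mA mB.
rewrite -[LHS]/(c%:num%:E * Q ((fun w => (U w, V w)) @^-1` (A `*` B) `&` D))%E setIC QE// muleA.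
by rewrite -{1}(fineK QDfin) -EFinM mulVf ?mul1e// gt_eqF.
Qed.

(** Induction on [l] with [D] general: an event of the head variable is absorbed into [D], the
    induction hypothesis then gives the law of the tail sum jointly with the head, and [product_law]
    with [normal_prob_add] adds the two. *)
Lemma normal_sum_law (J : eqType) (Z : J -> T -> R) (sd : J -> R) (l : seq J)
    (V : T -> R) (t : R) (D : set T) :
  measurable D -> (forall j, measurable_fun setT (Z j)) -> measurable_fun setT V ->
  (forall j, 0 < sd j) -> 0 < t -> uniq l ->
  (forall (B : J -> set R) A, (forall j, measurable (B j)) -> measurable A ->
    Q (D `&` ([set w | forall j, j \in l -> B j (Z j w)] `&` V @^-1` A)) =
    (Q D * ((\prod_(j <- l) fine (normal_prob 0 (sd j) (B j)))%:E *
            normal_prob 0 t A))%E) ->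
  forall A, measurable A ->
    Q (D `&` (fun w => \sum_(j <- l) Z j w + V w) @^-1` A) =
    (Q D * normal_prob 0 (Num.sqrt (\sum_(j <- l) sd j ^+ 2 + t ^+ 2)) A)%E.
Proof.
move=> mD mZ mV sd0 t0.
elim: l D mD => [|j l IH] D mD /= => [_ QE A mA|/andP[jl ul] QE A mA].
  have := QE (fun=> setT) A (fun=> measurableT) mA.
  rewrite !big_nil mul1e add0r sqrtr_sqr gtr0_norm// => <-.
  congr (Q _); apply/seteqP; split => w /=.
    by rewrite big_nil add0r => -[].
  by rewrite big_nil add0r => -[? [_ ?]].
set u := Num.sqrt (\sum_(i <- l) sd i ^+ 2 + t ^+ 2).
have u0 : 0 < u.
  by rewrite sqrtr_gt0 ltr_wpDl ?exprn_gt0// sumr_ge0// => i _; rewrite sqr_ge0.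
have uE : u ^+ 2 = \sum_(i <- l) sd i ^+ 2 + t ^+ 2.
  by rewrite sqr_sqrtr// addr_ge0 ?sqr_ge0// sumr_ge0// => i _; rewrite sqr_ge0.
pose W w := \sum_(i <- l) Z i w + V w.
have mW : measurable_fun setT W.
  by apply: measurable_funD => //; exact: measurable_sum.
have normfin (s : R) B : measurable B -> normal_prob 0 s B \is a fin_num.
  by move=> mB; exact: fin_num_measure.
have step B : measurable B -> forall A', measurable A' ->
    Q (D `&` (Z j @^-1` B `&` W @^-1` A')) =
    (Q D * (normal_prob 0 (sd j) B * normal_prob 0 u A'))%E.
  move=> mB A' mA'.
  have mD' : measurable (D `&` Z j @^-1` B).
    by apply: measurableI => //; rewrite -[_ @^-1` _]setTI; exact: mZ.
  (* Imposes [B] on the head index; as [j] is not in [l], the constraints on the tail are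
     unchanged. *)
  pose upd (F : J -> set R) i := if i == j then B else F i.
  have mupd F : (forall i, measurable (F i)) -> forall i, measurable (upd F i).
    by move=> mF i; rewrite /upd; case: ifP.
  have updj F : upd F j = B by rewrite /upd eqxx.
  have updE F : (forall i, measurable (F i)) -> forall A'', measurable A'' ->
      Q (D `&` Z j @^-1` B `&`
         ([set w | forall i, i \in l -> F i (Z i w)] `&` V @^-1` A'')) =
      (Q D * normal_prob 0 (sd j) B *
         ((\prod_(i <- l) fine (normal_prob 0 (sd i) (F i)))%:E *
          normal_prob 0 t A''))%E.
    move=> mF A'' mA''; have := QE (upd F) A'' (mupd F mF) mA''.
    rewrite big_cons updj EFinM fineK ?normfin//.
    have -> : \prod_(i <- l) fine (normal_prob 0 (sd i) (upd F i)) =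
              \prod_(i <- l) fine (normal_prob 0 (sd i) (F i)).
      rewrite big_seq [RHS]big_seq; apply: eq_bigr => i il.
      by rewrite /upd; case: eqP jl => // <-; rewrite il.
    rewrite -!muleA => <-; congr (Q _); apply/seteqP; split => w /=.
      move=> [[Dw Bw] [Fw Aw]]; split => //; split => // i; rewrite inE /upd.
      by case: eqP => [->//|_ /= /Fw].
    move=> [Dw [Fw Aw]]; split; first split => //.
      by have := Fw j; rewrite inE eqxx /upd eqxx; exact.
    split => // i il; have := Fw i; rewrite inE il orbT /upd.
    by case: eqP il jl => [-> ->//|_ _ _]; exact.
  have QD' : Q (D `&` Z j @^-1` B) = (Q D * normal_prob 0 (sd j) B)%E.
    have := updE (fun=> setT) (fun=> measurableT) setT measurableT.
    rewrite big1 => [|i _]; last by rewrite probability_setT.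
    rewrite probability_setT !mule1 => <-; congr (Q _).
    by apply/seteqP; split => w //= -[].
  have := IH _ mD' ul _ A' mA'; rewrite -setIA QD' -muleA; apply => F A'' mF mA''.
  by rewrite updE// muleA.
have := @product_law _ _ _ _ (normal_prob 0 (sd j)) (normal_prob 0 u) _ _ _ mD (mZ j) mW
  (fun B A' mB mA' => step B mB A' mA').
have mC : measurable [set z : R * R | A (z.1 + z.2)].
  rewrite -[X in measurable X]setTI.
  by apply: (measurable_funD measurable_fst measurable_snd) => //.
move=> /(_ _ mC) h.
have {}h := eq_trans h (congr1 (mule (Q D)) (normal_prob_add (sd0 j) u0 mA)).
rewrite uE in h.
rewrite big_cons -addrA -h; congr (Q (_ `&` _)).
by apply/seteqP; split => w /=; rewrite big_cons addrA.
Qed.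

End ProductLaw.

Section NormalMoments.
Context {R : realType}.
Local Notation mu := (@lebesgue_measure R).

Lemma ge0_integral_lebesgueN (f : R -> \bar R) :
  measurable_fun setT f -> (forall x, 0 <= f x)%E ->
  (\int[mu]_x f (- x)%R = \int[mu]_x f x)%E.
Proof.
move=> mf f0.
pose phi : measurableTypeR R -> measurableTypeR R := fun x => - x.
have mphi : measurable_fun setT phi by exact: oppr_measurable.
rewrite -[LHS](@ge0_integral_pushforward _ _ _ _ _ phi mphi mu setT f)//.
by apply: eq_measure_integral => A mA _; exact: lebesgue_measureN.
Qed.

Lemma normal_probN (s : R) (A : set R) : 0 < s -> measurable A ->
  normal_prob 0 s (-%R @^-1` A) = normal_prob 0 s A.
Proof.
move=> s0 mA; pose f : R -> \bar R := (EFin \o normal_pdf 0 s) \_ A.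
have mf : measurable_fun setT f.
  apply: (measurable_restrictT (EFin \o normal_pdf 0 s) mA).1.
  apply/measurable_funTS.
  by apply/measurable_EFinP; exact: measurable_normal_pdf.
have f0 x : (0 <= f x)%E.
  by apply: erestrict_ge0 => y _; rewrite lee_fin normal_pdf_ge0.
rewrite /normal_prob [LHS]integral_mkcond [RHS]integral_mkcond.
rewrite -[RHS](ge0_integral_lebesgueN mf f0); apply: eq_integral => x _.
rewrite /f !patchE.
have -> : (x \in -%R @^-1` A) = (- x \in A) by apply/idP/idP; rewrite !inE.
by case: ifP => // _ /=; rewrite !normal_pdf0E// !subr0 sqrrN.
Qed.

(* The value k = 1 is never needed: the second moments of the noise and of the output,
   each divided by its variance, cancel in the mean of the information density. *)
Lemma normal_second_moment : exists k : R, forall s : R, 0 < s ->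
  (\int[normal_prob 0 s]_x (x ^+ 2)%:E = (k * s ^+ 2)%:E)%E.
Proof.
pose p (s x : R) := x ^+ 2 * normal_pdf 0 s x.
have mpdf (m r : R) : measurable_fun setT (normal_pdf m r) by exact: measurable_normal_pdf.
have mpE (f : R -> R) : measurable_fun setT f ->
    measurable_fun (setT : set (measurableTypeR R)) (EFin \o f).
  by move=> mf; apply/measurable_EFinP.
have mp s : measurable_fun setT (p s).
  by apply: measurable_funM => //; exact: measurable_funX.
have p_ge0 s x : 0 <= p s x by rewrite mulr_ge0 ?sqr_ge0 ?normal_pdf_ge0.
have s20 : 0 < Num.sqrt 2 :> R by rewrite sqrtr_gt0.
(* Finiteness by comparison with the normal density of variance 2: half of the exponent absorbs the
   square, since [1 + x ^+ 2 / 4 <= expR (x ^+ 2 / 4)], and the other half is that density. *)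
have p1_le x : p 1 x <= 4 * Num.sqrt 2 * normal_pdf 0 (Num.sqrt 2) x.
  rewrite /p !normal_pdf0E// subr0 sqr_sqrtr// expr1n.
  have p0 : 0 < Num.sqrt (pi *+ 2) :> R.
    by rewrite sqrtr_gt0 mulrn_wgt0// pi_gt0.
  set e2 := expR (- x ^+ 2 / (2 *+ 2)).
  have -> : expR (- x ^+ 2 / (1 *+ 2)) = e2 * e2.
    by rewrite -expRD; congr expR; field.
  have e20 : 0 < e2 by exact: expR_gt0.
  have e2e : x ^+ 2 * e2 <= 4.
    have := expR_ge1Dx (x ^+ 2 / (2 *+ 2)).
    have -> : expR (x ^+ 2 / (2 *+ 2)) = e2^-1.
      by rewrite /e2 -expRN; congr expR; field.
    move=> h; rewrite -ler_pdivlMr//; move: h; rewrite -mulr_natr.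
    by move: (e2^-1) => z; lra.
  have -> : 4 * Num.sqrt 2 * ((Num.sqrt (pi *+ 2) * Num.sqrt 2)^-1 * e2) =
     (Num.sqrt (pi *+ 2) * 1)^-1 * e2 * 4 by field; rewrite !gt_eqF.
  have -> : x ^+ 2 * ((Num.sqrt (pi *+ 2) * 1)^-1 * (e2 * e2)) =
     (Num.sqrt (pi *+ 2) * 1)^-1 * e2 * (x ^+ 2 * e2) by field; rewrite !gt_eqF.
  by rewrite ler_wpM2l// mulr1 mulr_ge0 ?invr_ge0 ?(ltW p0) ?(ltW e20).
have I1 : (\int[mu]_x (p 1 x)%:E)%E \is a fin_num.
  rewrite ge0_fin_numE; last by apply: integral_ge0 => x _; rewrite lee_fin.
  apply: (@le_lt_trans _ _
    (\int[mu]_x ((4 * Num.sqrt 2)%:E * (normal_pdf 0 (Num.sqrt 2) x)%:E))%E).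
    apply: ge0_le_integral => //.
    - by move=> x _; rewrite lee_fin.
    - exact: mpE.
    - by apply: (mpE (fun x => 4 * Num.sqrt 2 * normal_pdf 0 (Num.sqrt 2) x));
        exact: measurable_funM.
    - by move=> x _; rewrite -EFinM lee_fin.
  rewrite ge0_integralZl//.
  - by rewrite integral_normal_pdf mule1 ltry.
  - exact: mpE.
  - by move=> x _; rewrite lee_fin normal_pdf_ge0.
exists (fine (\int[mu]_x (p 1 x)%:E)%E) => s s0.
rewrite EFinM fineK//.
rewrite ge0_integral_normal_prob//; first last.
- by move=> x; rewrite lee_fin sqr_ge0.
- by apply/measurable_EFinP; exact: measurable_funX.
(* Scaling reduces every deviation [s] to 1, which is why one [k] serves them all. *)
pose F (x : R^o) : R^o := s * x.
have F'E : F^`()%classic = cst s.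
  apply/funext => x; rewrite /F derive1E deriveM// derive_cst derive_id.
  by rewrite scaler0 addr0 scaler1.
transitivity (\int[mu]_x (p s x)%:E)%E.
  by apply: eq_integral => x _; rewrite -EFinM.
rewrite (@increasing_ge0_integration_by_substitutionT _ F (p s))//; first last.
- move=> x; apply: cvgM; first exact: sqr_continuous.
  by apply: continuous_normal_pdf; rewrite gt_eqF.
- by apply/gt0_cvgMry => //; exact: cvg_id.
- by apply/gt0_cvgMrNy => //; exact: cvg_id.
- by rewrite F'E; exact: is_cvg_cst.
- by rewrite F'E; exact: is_cvg_cst.
- by rewrite F'E => ?; exact: cvg_cst.
- by move=> x y xy; rewrite /F ltr_pM2l.
rewrite muleC -ge0_integralZl//; first last.
- by rewrite lee_fin sqr_ge0.
- by move=> x _; rewrite lee_fin.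
- exact: mpE.
apply: eq_integral => x _; rewrite F'E -EFinM; congr EFin.
rewrite -[LHS]/((s * x) ^+ 2 * normal_pdf 0 s (s * x) * s) /p !normal_pdf0E//.
have -> : - (s * x - 0) ^+ 2 / (s ^+ 2 *+ 2) = - (x - 0) ^+ 2 / (1 ^+ 2 *+ 2).
  by field; rewrite gt_eqF.
have p0 : Num.sqrt (pi *+ 2) != 0 :> R.
  by rewrite gt_eqF// sqrtr_gt0 mulrn_wgt0// pi_gt0.
by field; rewrite p0 gt_eqF.
Qed.
End NormalMoments.

(** * The complex Gaussian channel *)

Section GaussianChannel.
Context {R : realType} d (T : measurableType d) (Q : probability T R).
Variables (s t : R) (xR xI gR gI : T -> R).
Hypotheses (s0 : 0 < s) (t0 : 0 < t).
Hypotheses (mxR : measurable_fun setT xR) (mxI : measurable_fun setT xI).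
Hypotheses (mgR : measurable_fun setT gR) (mgI : measurable_fun setT gI).
Hypothesis joint : forall A1 A2 A3 A4 : set R,
  measurable A1 -> measurable A2 -> measurable A3 -> measurable A4 ->
  Q ((xR @^-1` A1 `&` xI @^-1` A2) `&` (gR @^-1` A3 `&` gI @^-1` A4)) =
  ((normal_prob 0 s A1 * normal_prob 0 s A2) *
   (normal_prob 0 t A3 * normal_prob 0 t A4))%E.

Let u := Num.sqrt (s ^+ 2 + t ^+ 2).
Let X w := (xR w, xI w).
Let G w := (gR w, gI w).
Let Y w := (xR w + gR w, xI w + gI w).
Let Ns : probability (measurableTypeR R) R := normal_prob 0 s.
Let Nt : probability (measurableTypeR R) R := normal_prob 0 t.
Let Nu : probability (measurableTypeR R) R := normal_prob 0 u.
Let Ns2 : probability (measurableTypeR R * measurableTypeR R)%type R := (Ns \x Ns)%E.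
Let Nt2 : probability (measurableTypeR R * measurableTypeR R)%type R := (Nt \x Nt)%E.
Let Nu2 : probability (measurableTypeR R * measurableTypeR R)%type R := (Nu \x Nu)%E.

Let uE : u ^+ 2 = s ^+ 2 + t ^+ 2.
Proof. by rewrite sqr_sqrtr// addr_ge0// sqr_ge0. Qed.

Let u0 : 0 < u.
Proof. by rewrite sqrtr_gt0 addr_gt0// exprn_gt0. Qed.

Let mX : measurable_fun setT X. Proof. exact: measurable_fun_pair. Qed.
Let mG : measurable_fun setT G. Proof. exact: measurable_fun_pair. Qed.
Let myR : measurable_fun setT (fun w => xR w + gR w).
Proof. exact: measurable_funD. Qed.
Let myI : measurable_fun setT (fun w => xI w + gI w).
Proof. exact: measurable_funD. Qed.
Let mY : measurable_fun setT Y. Proof. exact: measurable_fun_pair. Qed.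

Let pre d' (T' : measurableType d') (Z : T -> T') (A : set T') :
  measurable_fun setT Z -> measurable A -> measurable (Z @^-1` A).
Proof. by move=> mZ mA; rewrite -[_ @^-1` _]setTI; exact: mZ. Qed.

Let probE (Z : T -> R) (r : R) : 
  (forall A, measurable A -> Q (Z @^-1` A) = normal_prob 0 r A) ->
  forall (f : R -> \bar R), measurable_fun setT Z -> measurable_fun setT f ->
  (forall x, 0 <= f x)%E -> (\int[Q]_w f (Z w) = \int[normal_prob 0 r]_x f x)%E.
Proof.
move=> ZE f mZ mf f0.
pose Z' : T -> measurableTypeR R := Z.
have mZ' : measurable_fun setT Z' by [].
rewrite -[LHS](@ge0_integral_pushforward _ _ _ _ _ Z' mZ' Q setT f)//.
by apply: eq_measure_integral => A mA _; exact: ZE.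
Qed.

Let NsT : Ns setT = 1%E. Proof. exact: probability_setT. Qed.
Let NtT : Nt setT = 1%E. Proof. exact: probability_setT. Qed.
Let NuT : Nu setT = 1%E. Proof. exact: probability_setT. Qed.

(** Each use of [product_law] merges one pair: here [xR] with [xI], the noise event serving as [D].
    In [law_XG], [gR] and [gI] are merged over each event of [X], then [X] with [G]. *)
Let law_X A : measurable A -> forall A3 A4, measurable A3 -> measurable A4 ->
  Q ((gR @^-1` A3 `&` gI @^-1` A4) `&` X @^-1` A) =
  ((Nt A3 * Nt A4) * Ns2 A)%E.
Proof.
move=> mA A3 A4 m3 m4.
have QD : Q (gR @^-1` A3 `&` gI @^-1` A4) = (Nt A3 * Nt A4)%E.
  have := joint measurableT measurableT m3 m4.
  rewrite (probability_setT (normal_prob 0 s)) !mul1e !preimage_setT !setTI.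
  exact.
rewrite -QD; apply: (@product_law _ _ _ Q _ _ _ _ Ns Ns xR xI) => //.
  by apply: measurableI; exact: pre.
move=> A1 A2 m1 m2.
rewrite setIC.
rewrite (joint m1 m2 m3 m4).
rewrite QD.
exact: muleC.
Qed.

Let law_XG C : measurable C ->
  Q ((fun w => (X w, G w)) @^-1` C) = (Ns2 \x Nt2)%E C.
Proof.
move=> mC.
have step A : measurable A -> forall B, measurable B ->
    Q (X @^-1` A `&` G @^-1` B) = (Ns2 A * Nt2 B)%E.
  move=> mA B mB.
  have QD : Q (X @^-1` A) = Ns2 A.
    have := law_X mA measurableT measurableT.
    by rewrite !NtT !mul1e !preimage_setT !setTI.
  rewrite -QD; apply: (@product_law _ _ _ Q _ _ _ _ Nt Nt gR gI) => //; first exact: pre.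
  move=> A3 A4 m3 m4; rewrite setIC (law_X mA m3 m4) QD; exact: muleC.
have hyp A B : measurable A -> measurable B ->
    Q (setT `&` (X @^-1` A `&` G @^-1` B)) = (Q setT * (Ns2 A * Nt2 B))%E.
  by move=> mA mB; rewrite setTI probability_setT mul1e; exact: step.
have := @product_law _ _ _ Q _ _ _ _ Ns2 Nt2 X G setT measurableT mX mG hyp C mC.
by rewrite setTI probability_setT mul1e.
Qed.

(** The same scheme, with input paired to noise: the pairs with sum in [A] form a measurable set,
    whose product mass is given by [normal_prob_add]. The imaginary events stay in [D] so that
    [law_Y] can merge them next. *)
Let law_yR A : measurable A -> forall A2 A4, measurable A2 -> measurable A4 ->
  Q ((xI @^-1` A2 `&` gI @^-1` A4) `&` (fun w => xR w + gR w) @^-1` A) =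
  ((Ns A2 * Nt A4) * Nu A)%E.
Proof.
move=> mA A2 A4 m2 m4.
have mC : measurable [set z : R * R | A (z.1 + z.2)].
  rewrite -[X in measurable X]setTI.
  by apply: (measurable_funD measurable_fst measurable_snd) => //.
have QD : Q (xI @^-1` A2 `&` gI @^-1` A4) = (Ns A2 * Nt A4)%E.
  have := joint measurableT m2 measurableT m4.
  by rewrite !probability_setT !mul1e !preimage_setT !setTI.
have -> : Nu A = (Ns \x Nt)%E [set z | A (z.1 + z.2)].
  exact: esym (normal_prob_add s0 t0 mA).
rewrite -QD.
apply: (@product_law _ _ _ Q _ _ _ _ Ns Nt xR gR) => //.
  by apply: measurableI; exact: pre.
move=> A1 A3 m1 m3.
rewrite QD [RHS]muleC muleACA -(joint m1 m2 m3 m4); congr (Q _).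
by rewrite setIACA (setIC (xI @^-1` A2)) (setIC (gI @^-1` A4)).
Qed.

Let law_Y B : measurable B -> Q (Y @^-1` B) = Nu2 B.
Proof.
move=> mB.
have mC A : measurable A -> measurable [set z : R * R | A (z.1 + z.2)].
  move=> mA; rewrite -[X in measurable X]setTI.
  by apply: (measurable_funD measurable_fst measurable_snd) => //.
have step A : measurable A -> forall A', measurable A' ->
    Q ((fun w => xR w + gR w) @^-1` A `&` (fun w => xI w + gI w) @^-1` A') =
    (Nu A * Nu A')%E.
  move=> mA A' mA'.
  have QD : Q ((fun w => xR w + gR w) @^-1` A) = Nu A.
    have := law_yR mA measurableT measurableT.
    by rewrite NsT NtT !mul1e !preimage_setT !setTI.
  have -> : Nu A' = (Ns \x Nt)%E [set z | A' (z.1 + z.2)].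
    exact: esym (normal_prob_add s0 t0 mA').
  rewrite -QD.
  apply: (@product_law _ _ _ Q _ _ _ _ Ns Nt xI gI) => //; [exact: pre| |exact: mC].
  move=> A2 A4 m2 m4; rewrite setIC (law_yR mA m2 m4) QD; exact: muleC.
have hyp A A' : measurable A -> measurable A' ->
    Q (setT `&` ((fun w => xR w + gR w) @^-1` A `&` (fun w => xI w + gI w) @^-1` A')) =
    (Q setT * (Nu A * Nu A'))%E.
  by move=> mA mA'; rewrite setTI probability_setT mul1e; exact: step.
have := @product_law _ _ _ Q _ _ _ _ Nu Nu _ _ _ measurableT myR myI hyp B mB.
by rewrite setTI probability_setT mul1e.
Qed.

Let l (x y : R * R) := normal_llr t u x.1 y.1 + normal_llr t u x.2 y.2.

(** By Tonelli, the real kernel identity is applied once per coordinate: to the section [K] inside,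
    then to its integral [H]. *)
Let kernel2 (x : R * R) (B : set (R * R)) : measurable B ->
  (\int[Nt2]_g ((\1_B (x.1 + g.1, x.2 + g.2)%R)%:E *
      (expR (- l x (x.1 + g.1, x.2 + g.2)))%:E))%E = Nu2 B.
Proof.
move=> mB; case: x => x1 x2.
pose F (g : R * R) : \bar R := ((\1_B (x1 + g.1, x2 + g.2)%R)%:E *
      (expR (- l (x1, x2) (x1 + g.1, x2 + g.2)))%:E)%E.
have m1 : measurable_fun setT (fun g : R * R => x1 + g.1) by exact: measurable_funD.
have m2 : measurable_fun setT (fun g : R * R => x2 + g.2) by exact: measurable_funD.
have m12 : measurable_fun setT (fun g : R * R => (x1 + g.1, x2 + g.2)).
  exact: measurable_fun_pair.
have mI : measurable_fun setT (fun y => (\1_B y : R)%:E).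
  by apply/measurable_EFinP; exact: measurable_indic.
have mF : measurable_fun setT F.
  apply: emeasurable_funM.
    apply/measurable_EFinP.
    by apply: (measurableT_comp _ m12); exact: measurable_indic.
  apply/measurable_EFinP; apply: measurableT_comp => //; apply: measurableT_comp => //.
  by apply: measurable_funD; exact: measurable_normal_llr.
have F0 g : (0 <= F g)%E by rewrite mule_ge0// lee_fin expR_ge0.
rewrite -[LHS]/(\int[Nt2]_g F g)%E.
rewrite (@fubini_tonelli1 _ _ _ _ R Nt Nt F mF F0) /fubini_F /=.
pose H y1 : \bar R := (\int[Nu]_y2 (\1_B (y1, y2) : R)%:E)%E.
have H0 y1 : (0 <= H y1)%E by apply: integral_ge0 => y _; rewrite lee_fin.
have mH : measurable_fun setT H.
  apply: (@measurable_fun_fubini_tonelli_F _ _ _ _ R Nu (fun y => (\1_B y : R)%:E) mI).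
  by move=> y; rewrite lee_fin.
transitivity (\int[Nu]_y1 H y1)%E; last first.
  have <- : (\int[Nu2]_y (\1_B y : R)%:E)%E = Nu2 B.
    by rewrite (@integral_indic _ _ _ Nu2 setT measurableT B mB) setIT.
  by rewrite (@fubini_tonelli1 _ _ _ _ R Nu Nu (fun y => (\1_B y : R)%:E) mI).
refine (eq_trans _ (@integral_normal_llr_kernel _ t u x1 H t0 u0 mH H0)).
apply: eq_integral => g1 _.
pose K y2 : \bar R := (\1_B ((x1 + g1)%R, y2) : R)%:E.
have K0 y2 : (0 <= K y2)%E by rewrite lee_fin.
have mK : measurable_fun setT K by exact: (measurable_fun_pair2 _ mI).
have -> : H (x1 + g1) = (\int[Nt]_g2 (K (x2 + g2)%R *
    (expR (- normal_llr t u x2 (x2 + g2)))%:E))%E.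
  exact: esym (@integral_normal_llr_kernel _ t u x2 K t0 u0 mK K0).
have m3 : measurable_fun setT (fun g : R => x2 + g) by exact: measurable_funD.
rewrite muleC -ge0_integralZl//; first last.
- by move=> y _; rewrite mule_ge0// lee_fin expR_ge0.
- apply: emeasurable_funM; first exact: (measurableT_comp mK m3).
  apply/measurable_EFinP; apply: measurableT_comp => //; apply: measurableT_comp => //.
  exact: measurable_normal_llr.
apply: eq_integral => g2 _; rewrite /F /K /l /=.
by rewrite opprD expRD EFinM muleCA.
Qed.

(** Written as a double integral over input and noise; for a fixed input the inner integral is
    [Nu2 B] whatever the input, so the product factors. *)
Let dens A B : measurable A -> measurable B ->
  (\int[Q]_(w in X @^-1` A `&` Y @^-1` B) (expR (- l (X w) (Y w)))%:E =
   Q (X @^-1` A) * Q (Y @^-1` B))%E.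
Proof.
move=> mA mB.
pose F (z : (R * R) * (R * R)) : \bar R := ((\1_A z.1 : R)%:E *
  ((\1_B (z.1.1 + z.2.1, z.1.2 + z.2.2)%R)%:E *
   (expR (- l z.1 (z.1.1 + z.2.1, z.1.2 + z.2.2)))%:E))%E.
have mF : measurable_fun setT F.
  have m11 : measurable_fun setT (fun z : (R * R) * (R * R) => z.1.1).
    exact: measurableT_comp.
  have m12 : measurable_fun setT (fun z : (R * R) * (R * R) => z.1.2).
    exact: measurableT_comp.
  have ms1 : measurable_fun setT (fun z : (R * R) * (R * R) => z.1.1 + z.2.1).
    by apply: measurable_funD => //; exact: measurableT_comp.
  have ms2 : measurable_fun setT (fun z : (R * R) * (R * R) => z.1.2 + z.2.2).
    by apply: measurable_funD => //; exact: measurableT_comp.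
  apply: emeasurable_funM; last apply: emeasurable_funM.
  - apply/measurable_EFinP.
    by apply: (measurableT_comp _ measurable_fst); exact: measurable_indic.
  - apply/measurable_EFinP.
    apply: (measurableT_comp _ (measurable_fun_pair ms1 ms2)).
    exact: measurable_indic.
  - apply/measurable_EFinP; apply: measurableT_comp => //; apply: measurableT_comp => //.
    by apply: measurable_funD; exact: measurable_normal_llr.
have F0 z : (0 <= F z)%E by rewrite !mule_ge0// lee_fin expR_ge0.
have mW : measurable_fun setT (fun w => (X w, G w)) by exact: measurable_fun_pair.
transitivity (\int[Q]_w F (X w, G w))%E.
  rewrite integral_mkcond; apply: eq_integral => w _.
  rewrite patchE /F /= !indicE.
  have -> : (w \in X @^-1` A `&` Y @^-1` B) = (X w \in A) && (Y w \in B).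
    by rewrite in_setI; congr andb; apply/idP/idP; rewrite !inE.
  rewrite -/(X w) -/(Y w); case: (X w \in A); case: (Y w \in B) => /=;
    by rewrite ?mul1e ?mul0e.
pose W : T -> (measurableTypeR R * measurableTypeR R) *
  (measurableTypeR R * measurableTypeR R) := fun w => (X w, G w).
have mW' : measurable_fun setT W by [].
rewrite -[LHS](@ge0_integral_pushforward _ _ _ _ _ W mW' Q setT F)//.
transitivity (\int[(Ns2 \x Nt2)%E]_z F z)%E.
  by apply: eq_measure_integral => C mC _; exact: law_XG.
rewrite (@fubini_tonelli1 _ _ _ _ R Ns2 Nt2 F mF F0) /fubini_F /F /=.
have -> : Q (X @^-1` A) = Ns2 A.
  have := law_X mA measurableT measurableT.
  by rewrite !NtT !mul1e !preimage_setT !setTI.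
rewrite law_Y//.
transitivity (\int[Ns2]_x ((\1_A x : R)%:E * Nu2 B))%E; last first.
  rewrite ge0_integralZr//.
    by rewrite (@integral_indic _ _ _ Ns2 setT measurableT A mA) setIT.
  by apply/measurable_EFinP; exact: measurable_indic.
apply: eq_integral => x _; rewrite -(kernel2 x mB).
have mFx : measurable_fun setT (fun g : R * R =>
    ((\1_B (x.1 + g.1, x.2 + g.2)%R)%:E *
     (expR (- l x (x.1 + g.1, x.2 + g.2)))%:E)%E).
  have ms1 : measurable_fun setT (fun g : R * R => x.1 + g.1).
    exact: measurable_funD.
  have ms2 : measurable_fun setT (fun g : R * R => x.2 + g.2).
    exact: measurable_funD.
  apply: emeasurable_funM.
    apply/measurable_EFinP.
    apply: (measurableT_comp _ (measurable_fun_pair ms1 ms2)).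
    exact: measurable_indic.
  apply/measurable_EFinP; apply: measurableT_comp => //; apply: measurableT_comp => //.
  by apply: measurable_funD; exact: measurable_normal_llr.
by rewrite (@ge0_integralZl _ _ _ Nt2 setT measurableT _ mFx).
Qed.

Let sq_moment (k r : R) (Z : T -> R) :
  (\int[normal_prob 0 r]_x (x ^+ 2)%:E = (k * r ^+ 2)%:E)%E ->
  measurable_fun setT Z ->
  (forall A, measurable A -> Q (Z @^-1` A) = normal_prob 0 r A) ->
  Q.-integrable setT (EFin \o (fun w => Z w ^+ 2)) /\
  \int[Q]_w (Z w ^+ 2) = k * r ^+ 2.
Proof.
move=> kE mZ ZE.
have msq : measurable_fun setT (fun x : R => (x ^+ 2)%:E).
  by apply/measurable_EFinP; exact: measurable_funX.
have sq0 (x : R) : (0 <= (x ^+ 2)%:E)%E by rewrite lee_fin sqr_ge0.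
have IE : (\int[Q]_w (Z w ^+ 2)%:E)%E = (k * r ^+ 2)%:E.
  by rewrite -kE; exact: (@probE Z r ZE (fun x => (x ^+ 2)%:E)).
split; last by rewrite /Rintegral IE.
apply/integrableP; split.
  by apply/measurable_EFinP; exact: measurable_funX.
under eq_integral do rewrite /= ger0_norm ?sqr_ge0//.
by rewrite IE ltry.
Qed.

Let gR_law A : measurable A -> Q (gR @^-1` A) = normal_prob 0 t A.
Proof.
move=> mA; have := joint measurableT measurableT mA measurableT.
by rewrite (probability_setT Ns) (probability_setT Nt) !mul1e mule1 !preimage_setT
  !setTI setIT.
Qed.

Let gI_law A : measurable A -> Q (gI @^-1` A) = normal_prob 0 t A.
Proof.
move=> mA; have := joint measurableT measurableT measurableT mA.
by rewrite (probability_setT Ns) (probability_setT Nt) !mul1e !preimage_setT !setTI.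
Qed.

Let yR_law A : measurable A -> Q ((fun w => xR w + gR w) @^-1` A) = normal_prob 0 u A.
Proof.
move=> mA; have := law_yR mA measurableT measurableT.
by rewrite NsT NtT !mul1e !preimage_setT !setTI.
Qed.

Let yI_law A : measurable A -> Q ((fun w => xI w + gI w) @^-1` A) = normal_prob 0 u A.
Proof.
move=> mA; have := law_Y (measurableX measurableT mA).
have -> : Nu2 (setT `*` A) = (Nu setT * Nu A)%E.
  exact: (@product_measure1E _ _ _ _ R Nu Nu setT A measurableT mA).
rewrite NuT mul1e => <-.
by congr (Q _); apply/seteqP; split => w //= -[].
Qed.

Let lE w : l (X w) (Y w) = 2 * ln (u / t) +
  (- (t ^+ 2 *+ 2)^-1 * gR w ^+ 2 + - (t ^+ 2 *+ 2)^-1 * gI w ^+ 2 +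
   ((u ^+ 2 *+ 2)^-1 * (xR w + gR w) ^+ 2 + (u ^+ 2 *+ 2)^-1 * (xI w + gI w) ^+ 2)).
Proof.
rewrite /l /normal_llr /=.
have -> : xR w + gR w - xR w = gR w by ring.
have -> : xI w + gI w - xI w = gI w by ring.
ring.
Qed.

Let l_integral : Q.-integrable setT (EFin \o (fun w => l (X w) (Y w))) /\
  \int[Q]_w l (X w) (Y w) = 2 * ln (u / t).
Proof.
have [k kE] := @normal_second_moment R.
have [i1 e1] := sq_moment (kE t t0) mgR gR_law.
have [i2 e2] := sq_moment (kE t t0) mgI gI_law.
have [i3 e3] := sq_moment (kE u u0) myR yR_law.
have [i4 e4] := sq_moment (kE u u0) myI yI_law.
have scale a (f : T -> R) : Q.-integrable setT (EFin \o f) ->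
    Q.-integrable setT (EFin \o (fun w => a * f w)).
  by move=> /(integrableZl measurableT a).
have add (f g : T -> R) : Q.-integrable setT (EFin \o f) ->
    Q.-integrable setT (EFin \o g) -> Q.-integrable setT (EFin \o (fun w => f w + g w)).
  by move=> i j; exact: (integrableD measurableT i j).
set a := - (t ^+ 2 *+ 2)^-1; set b := (u ^+ 2 *+ 2)^-1.
have j1 := scale a _ i1; have j2 := scale a _ i2.
have j3 := scale b _ i3; have j4 := scale b _ i4.
have j12 := add _ _ j1 j2; have j34 := add _ _ j3 j4.
have j14 := add _ _ j12 j34.
have jc : Q.-integrable setT (EFin \o (fun=> 2 * ln (u / t))).
  exact: finite_measure_integrable_cst.
have -> : (fun w => l (X w) (Y w)) = (fun w => 2 * ln (u / t) +
    (a * gR w ^+ 2 + a * gI w ^+ 2 +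
     (b * (xR w + gR w) ^+ 2 + b * (xI w + gI w) ^+ 2))).
  by apply/funext => w; exact: lE.
split; first exact: (add _ _ jc j14).
rewrite (RintegralD measurableT jc j14) (RintegralD measurableT j12 j34).
rewrite (RintegralD measurableT j1 j2) (RintegralD measurableT j3 j4).
have val c (f : T -> R) v : Q.-integrable setT (EFin \o f) ->
    \int[Q]_w f w = v -> \int[Q]_w (c * f w) = c * v.
  by move=> i <-; rewrite RintegralZl.
rewrite (val a _ _ i1 e1) (val a _ _ i2 e2) (val b _ _ i3 e3) (val b _ _ i4 e4).
have -> : \int[Q]_w (2 * ln (u / t)) = 2 * ln (u / t).
  have h := integral_cst Q measurableT (2 * ln (u / t))%:E.
  have h1 := congr1 (mule (2 * ln (u / t))%:E) (probability_setT Q).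
  by have := congr1 fine (etrans h h1); rewrite mule1.
by rewrite /a /b; field; rewrite !gt_eqF.
Qed.

Let l_unif r e : 0 < e -> exists2 h, 0 < h & forall x x' y y',
    interval_box r x -> interval_box r x' ->
    interval_box r y -> interval_box r y' ->
    `|x.1 - x'.1| <= h -> `|x.2 - x'.2| <= h ->
    `|y.1 - y'.1| <= h -> `|y.2 - y'.2| <= h -> l x y <= l x' y' + e.
Proof.
move=> e0.
(* A Lipschitz constant of [normal_llr] on the box: for points within [h], the two squares change by
   at most [2 * h * 4 * r] and [h * 2 * r], and are divided by [2 * t ^+ 2] and [2 * u ^+ 2]. *)
pose K := `|r| * 4 / t ^+ 2 + `|r| / u ^+ 2.
have K0 : 0 <= K.
  by rewrite addr_ge0// mulr_ge0 ?invr_ge0 ?sqr_ge0 ?mulr_ge0.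
have lip h x x' y y' : - r <= x < r -> - r <= x' < r -> - r <= y < r ->
    - r <= y' < r -> `|x - x'| <= h -> `|y - y'| <= h ->
    normal_llr t u x y <= normal_llr t u x' y' + h * K.
  move=> /andP[xa xb] /andP[xa' xb'] /andP[ya yb] /andP[ya' yb'] xx yy.
  have r0 : 0 < r by lra.
  have h0 : 0 <= h by exact: le_trans (normr_ge0 _) xx.
  have sqdiff (c c' m M : R) : `|c - c'| <= m -> `|c + c'| <= M -> c ^+ 2 - c' ^+ 2 <= m * M.
    move=> cm cM; rewrite subr_sqr; apply: le_trans (ler_norm _) _.
    by rewrite normrM ler_pM.
  have d1 : (y' - x') ^+ 2 - (y - x) ^+ 2 <= (h + h) * (r * 4).
    apply: sqdiff.
      have -> : y' - x' - (y - x) = (x - x') - (y - y') by ring.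
      by apply: le_trans (ler_normB _ _) _; apply: lerD.
    by rewrite ler_norml; apply/andP; split; lra.
  have d2 : y ^+ 2 - y' ^+ 2 <= h * (r * 2).
    by apply: sqdiff => //; rewrite ler_norml; apply/andP; split; lra.
  have t2 : 0 < t ^+ 2 by rewrite exprn_gt0.
  have u2 : 0 < u ^+ 2 by rewrite exprn_gt0.
  rewrite /normal_llr /K gtr0_norm//.
  have -> : ln (u / t) - (y' - x') ^+ 2 / (t ^+ 2 *+ 2) + y' ^+ 2 / (u ^+ 2 *+ 2) +
     h * (r * 4 / t ^+ 2 + r / u ^+ 2) =
     ln (u / t) - ((y' - x') ^+ 2 - (h + h) * (r * 4)) / (t ^+ 2 *+ 2) +
       (y' ^+ 2 + h * (r * 2)) / (u ^+ 2 *+ 2) by field; rewrite !gt_eqF.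
  apply: lerD; first apply: lerB => //.
    by rewrite ler_pM2r ?invr_gt0 ?mulrn_wgt0//; lra.
  by rewrite ler_pM2r ?invr_gt0 ?mulrn_wgt0//; lra.
(* Two coordinates each contribute [h * K]; the added 1 keeps the denominator positive. *)
exists (e / (K * 2 + 1)); first by rewrite divr_gt0// ltr_wpDl// mulr_ge0.
move=> x x' y y' [? ?] [? ?] [? ?] [? ?] ? ? ? ?.
pose h := e / (K * 2 + 1).
have l1 : normal_llr t u x.1 y.1 <= normal_llr t u x'.1 y'.1 + h * K by exact: lip.
have l2 : normal_llr t u x.2 y.2 <= normal_llr t u x'.2 y'.2 + h * K by exact: lip.
have hK : h * K + h * K <= e.
  rewrite -mulrDr /h mulrAC ler_pdivrMr ?ltr_wpDl ?mulr_ge0//.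
  by rewrite ler_pM2l//; lra.
by rewrite /l; lra.
Qed.

Lemma mutual_info_gaussian_channel :
  mutual_info (fun A => fine (Q A)) (fun w => (xR w, xI w))
    (fun w => (xR w + gR w, xI w + gI w)) = (log2 (1 + s ^+ 2 / t ^+ 2))%:E.
Proof.
have [iL eL] := l_integral.
rewrite (mutual_info_density mX mY iL dens l_unif) eL /log2; congr (_ / _)%:E.
(* The factor 2 of the two real dimensions becomes the square in [u ^+ 2 / t ^+ 2]. *)
rewrite mulrC mulr_natr -lnXn ?divr_gt0// expr_div_n uE.
by congr ln; field; rewrite gt_eqF.
Qed.

End GaussianChannel.

(** * From binomial to Poisson expectations *)

Section PoissonLimit.
Context {R : realType}.

Lemma tannery (a : nat -> nat -> R) (b M : nat -> R) (m : nat -> nat) :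
  (forall n i, `|a n i| <= M i) -> (forall n i, (m n <= i)%N -> a n i = 0) ->
  cvgn (series M) -> (forall i, a n i @[n --> \oo] --> b i) ->
  (\sum_(i < m n) a n i) @[n --> \oo] --> limn (series b).
Proof.
move=> aM a0 cM ab.
have bM i : `|b i| <= M i.
  rewrite -(cvg_lim _ (cvg_norm (ab i)))//.
  apply: limr_le; first by apply/cvg_ex; eexists; exact: cvg_norm (ab i).
  by near=> n; exact: aM.
have cb : cvgn (series b).
  apply: normed_cvg; apply: series_le_cvg cM => // i.
    exact: normr_ge0.
  exact: le_trans (normr_ge0 _) (bM i).
apply/cvgrPdist_le => e e0; have e40 : 0 < e / 4 by rewrite divr_gt0.
have [I0 _ cauM] : \forall I \near \oo, forall n, (I <= n)%N ->
    \sum_(I <= i < n) M i <= e / 4.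
  move/cauchy_cvgP : (cM) => /cauchy_seriesP/(_ _ e40).
  case=> -[A B] /= [[n1 _ An1] [n2 _ Bn2]] AB.
  exists (maxn n1 n2) => // I /= ; rewrite geq_max => /andP[I1 I2] n In.
  have := AB (I, n) (conj (An1 _ I1) (Bn2 _ (leq_trans I2 In))).
  by move=> /ltW; apply: le_trans; exact: ler_norm.
have [I1 _ limb] : \forall I \near \oo, `|limn (series b) - series b I| <= e / 4.
  by move/cvgrPdist_le : cb; exact.
pose I := maxn I0 I1.
have tailM n : (I <= n)%N -> \sum_(I <= i < n) M i <= e / 4.
  by apply: cauM; exact: leq_maxl.
have limbI : `|limn (series b) - series b I| <= e / 4 by apply: limb; exact: leq_maxr.
have cI : (\sum_(0 <= i < I) a n i) @[n --> \oo] --> series b I.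
  rewrite /series /=; elim: I {tailM limbI} => [|j IH].
    by under eq_fun do rewrite big_nil; rewrite big_nil; exact: cvg_cst.
  under eq_fun do rewrite big_nat_recr//=; rewrite big_nat_recr//=.
  exact: cvgD.
near=> n.
(* Padding with zero terms makes the sum reach past [I] whatever [m n] is, so it can be cut at
   [I]. *)
have -> : \sum_(i < m n) a n i = \sum_(0 <= i < maxn (m n) I) a n i.
  rewrite -(big_mkord xpredT (a n)) [RHS](big_cat_nat (n := m n))//= ?leq_maxl//.
  rewrite [X in _ = _ + X]big_nat_cond [X in _ = _ + X]big1 ?addr0//.
  by move=> i /andP[/andP[/a0]].
rewrite (big_cat_nat (n := I))//= ?leq_maxr//.
have h1 : `|series b I - \sum_(0 <= i < I) a n i| <= e / 4.
  by near: n; move/cvgrPdist_le : cI; exact.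
set s1 := \sum_(0 <= i < I) _ in h1 *; set s2 := \sum_(I <= i < _) _.
have h2 : `|s2| <= e / 4.
  apply: le_trans (tailM _ (leq_maxr (m n) I)).
  apply: le_trans (ler_norm_sum _ _ _) _.
  by apply: ler_sum => i _; exact: aM.
have -> : limn (series b) - (s1 + s2) =
  (limn (series b) - series b I) + (series b I - s1) - s2 by ring.
apply: le_trans (ler_normB _ _) _; apply: le_trans (lerD (ler_normD _ _) (lexx _)) _.
by lra.
Unshelve. all: end_near. Qed.

(** Squeeze between powers of [expR (- p / (1 - p)) <= 1 - p <= expR (- p)]; both bounds come from
    [1 + x <= expR x], the lower one after inversion. *)
Lemma cvg_expR_onemX (p : nat -> R) (m : nat -> nat) (b : R) :
  (forall n, 0 <= p n) -> (forall n, p n <= 1) -> p n @[n --> \oo] --> 0 ->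
  ((m n)%:R * p n) @[n --> \oo] --> b ->
  ((1 - p n) ^+ m n) @[n --> \oo] --> expR (- b).
Proof.
move=> p_ge0 p_le1 p0 mp.
have ub n : (1 - p n) ^+ m n <= expR (- ((m n)%:R * p n)).
  rewrite -mulrN expRM_natl; apply: lerXn2r; rewrite ?nnegrE ?expR_ge0 ?subr_ge0//.
  exact: (expR_ge1Dx (- p n)).
have lb n : p n < 1 -> expR (- ((m n)%:R * p n / (1 - p n))) <= (1 - p n) ^+ m n.
  move=> p1; have q0 : 0 < 1 - p n by rewrite subr_gt0.
  rewrite -mulrA -mulrN expRM_natl; apply: lerXn2r; rewrite ?nnegrE ?expR_ge0 ?(ltW q0)//.
  rewrite expRN -[leRHS]invrK lef_pV2 ?posrE ?invr_gt0 ?expR_gt0//.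
  rewrite [leLHS](_ : _ = 1 + p n / (1 - p n)); last by field; rewrite gt_eqF.
  exact: expR_ge1Dx.
apply: (@squeeze_cvgr _ _ _ _ (fun n => expR (- ((m n)%:R * p n / (1 - p n)))) 
  (fun n => expR (- ((m n)%:R * p n)))).
- near=> n; rewrite ub andbT; apply: lb; near: n.
  by apply: cvgr_lt p0 _ _; exact: ltr01.
- apply: (@cvg_comp _ _ _ _ expR _ (nbhs (- b))); last exact: continuous_expR.
  apply: cvgN; rewrite -[X in _ --> X](_ : b / (1 - 0) = b); last by rewrite subr0 divr1.
  apply: cvgM => //; apply: cvgV; first by rewrite subr0 oner_eq0.
  by apply: cvgB => //; exact: cvg_cst.
- apply: (@cvg_comp _ _ _ _ expR _ (nbhs (- b))); last exact: continuous_expR.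
  exact: cvgN.
Unshelve. all: end_near. Qed.

Definition binomial_weight (m : nat) (p : R) (i : nat) : R :=
  'C(m, i)%:R * p ^+ i * (1 - p) ^+ (m - i).

(** The falling factorial [m ^_ i] is at most [m ^ i]. With [m * p] bounded this is an exponential
    series term, the majorant for [tannery]. *)
Lemma binomial_weight_le (m : nat) (p : R) (i : nat) : 0 <= p <= 1 ->
  0 <= binomial_weight m p i <= (m%:R * p) ^+ i / i`!%:R.
Proof.
move=> /andP[p0 p1]; have q0 : 0 <= 1 - p by rewrite subr_ge0.
have q1 : 1 - p <= 1 by rewrite gerBl.
rewrite /binomial_weight !mulr_ge0 ?exprn_ge0//= ler_pdivlMr ?ltr0n ?fact_gt0//.
apply: (@le_trans _ _ ('C(m, i)%:R * p ^+ i * i`!%:R)).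
  rewrite ler_wpM2r// ler_piMr ?mulr_ge0 ?exprn_ge0//; exact: exprn_ile1.
rewrite mulrAC -natrM bin_ffact exprMn ler_wpM2r ?exprn_ge0// -natrX ler_nat.
elim: i => [|i IH]; first by rewrite ffactn0 expn0.
by rewrite ffactnSr expnSr leq_mul// leq_subr.
Qed.

Lemma cvg_binomial_weight (p : nat -> R) (m : nat -> nat) (b : R) (i : nat) :
  (forall n, 0 <= p n) -> (forall n, p n <= 1) -> p n @[n --> \oo] --> 0 ->
  ((m n)%:R * p n) @[n --> \oo] --> b ->
  binomial_weight (m n) (p n) i @[n --> \oo] --> b ^+ i * expR (- b) / i`!%:R.
Proof.
move=> p_ge0 p_le1 p0 mp.
(* Handles both the factors of the falling factorial and the exponent [m n - i]; the subtraction is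
   truncated, hence the [minn]. *)
have sub j : ((m n - j)%N%:R * p n) @[n --> \oo] --> b.
  have -> : (fun n => (m n - j)%N%:R * p n) =
            (fun n => (m n)%:R * p n - (minn (m n) j)%:R * p n).
    by apply/funext => n; rewrite -mulrBl -natrB ?geq_minl//; congr (_%:R * _); lia.
  rewrite -[X in _ --> X]subr0; apply: cvgB => //.
  apply: (@squeeze_cvgr _ _ _ _ (fun=> 0) (fun n => j%:R * p n)).
  - near=> n; rewrite mulr_ge0//= ler_wpM2r// ler_nat; exact: geq_minr.
  - exact: cvg_cst.
  - by rewrite -[X in _ --> X](mulr0 j%:R); apply: cvgM => //; exact: cvg_cst.
have ff : ((m n ^_ i)%:R * p n ^+ i) @[n --> \oo] --> b ^+ i.
  elim: i => [|i IH].
    by under eq_fun do rewrite ffactn0 expr0 mulr1; rewrite expr0; exact: cvg_cst.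
  under eq_fun do rewrite ffactnSr natrM exprSr mulrACA.
  by rewrite exprSr; exact: cvgM.
have -> : (fun n => binomial_weight (m n) (p n) i) =
  (fun n => (m n ^_ i)%:R * p n ^+ i * (1 - p n) ^+ (m n - i) / i`!%:R).
  apply/funext => n; rewrite /binomial_weight -bin_ffact natrM.
  by field; rewrite pnatr_eq0 -lt0n fact_gt0.
by apply: cvgMl; apply: cvgM => //; exact: cvg_expR_onemX.
Unshelve. all: end_near. Qed.

Lemma binomial_poisson_expectation (p : nat -> R) (m : nat -> nat) (b c : R)
    (f : nat -> R) :
  (forall n, 0 <= p n) -> (forall n, p n <= 1) -> p n @[n --> \oo] --> 0 ->
  ((m n)%:R * p n) @[n --> \oo] --> b -> (forall i, `|f i| <= c) ->
  (\sum_(i < (m n).+1) binomial_weight (m n) (p n) i * f i) @[n --> \oo] -->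
  limn (series (fun i => b ^+ i * expR (- b) / i`!%:R * f i)).
Proof.
move=> p_ge0 p_le1 p0 mp fc.
have [B mpB] : exists B, forall n, (m n)%:R * p n <= B.
  have cmp : cvgn (fun n => (m n)%:R * p n) by apply/cvg_ex; exists b.
  have [B0 [_ /(_ (B0 + 1)) hB]] := cvg_seq_bounded cmp.
  exists (B0 + 1) => n; apply: le_trans (ler_norm _) _.
  by apply: hB => //; rewrite ltrDl.
have B_ge0 : 0 <= B by apply: le_trans (mpB 0%N); rewrite mulr_ge0.
have c_ge0 : 0 <= c by exact: le_trans (normr_ge0 _) (fc 0%N).
apply: (@tannery (fun n i => binomial_weight (m n) (p n) i * f i) _
  (fun i => c * (B ^+ i / i`!%:R)) (fun n => (m n).+1)).
- move=> n i; have /andP[w0 w1] := @binomial_weight_le (m n) (p n) i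
    (introT andP (conj (p_ge0 n) (p_le1 n))).
  rewrite normrM ger0_norm// mulrC ler_pM//.
  apply: le_trans w1 _; rewrite ler_wpM2r ?invr_ge0//.
  by apply: lerXn2r; rewrite ?nnegrE// mulr_ge0.
- by move=> n i mi; rewrite /binomial_weight bin_small// !mul0r.
- have -> : (fun i => c * (B ^+ i / i`!%:R)) = c *: exp_coeff B.
    by apply/funext.
  exact: is_cvg_seriesZ (is_cvg_series_exp_coeff B).
- by move=> i; apply: cvgMl; exact: cvg_binomial_weight.
Qed.

End PoissonLimit.

(** * The law of the number of collisions *)

Section Collisions.
Context {R : realType} (K' N' : nat).

Definition collisions (s : SType K' N') : nat :=
  \sum_(j < K'.+1 | j != ord0) ((s j).1 == (s ord0).1).

Lemma collisions_le s : (collisions s <= K')%N.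
Proof.
rewrite -[leqRHS](card_ord K') -sum1_card /collisions.
have -> : (\sum_(j < K') 1 = \sum_(j < K'.+1 | j != ord0) 1)%N.
  by rewrite !sum1_card cardC1 !card_ord.
by apply: leq_sum => j _; case: (_ == _).
Qed.

(** Once the chip of user [ord0] is fixed, the sum over matrices factors over users. Every other
    user contributes [2 * ('X + N')], the 2 counting signs, and [sum_collisions] reads off the
    coefficients. *)
Lemma collisions_generating_poly :
  \sum_(s : SType K' N') 'X^(collisions s) =
  ((2 * N'.+1) ^ K'.+1)%:R%:P *
    (N'.+1%:R^-1 *: 'X + (1 - N'.+1%:R^-1)%:P) ^+ K' :> {poly R}.
Proof.
(* Factor of user [j] when user [ord0] is on chip [a]: an indicator for [ord0] itself, and a power
   of 'X marking a collision for the others. *)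
pose G a j (v : 'I_N'.+1 * bool) : {poly R} :=
  if j == ord0 :> 'I_K'.+1 then (v.1 == a)%:R else 'X^(v.1 == a).
have sum_v (F : bool -> {poly R}) (a : 'I_N'.+1) :
    \sum_(v : 'I_N'.+1 * bool) F (v.1 == a) = (F true + F false *+ N') *+ 2.
  rewrite -(pair_bigA _ (fun i (_ : bool) => F (i == a))) /=.
  rewrite (eq_bigr (fun i => F (i == a) *+ 2)); last first.
    by move=> i _; rewrite big_const card_bool /= addr0 mulr2n.
  rewrite sumrMnl; congr (_ *+ 2); rewrite (bigD1 a)//= eqxx; congr (_ + _).
  rewrite (eq_bigr (fun=> F false)); last by move=> i /negPf ->.
  rewrite sumr_const; congr (_ *+ _).
  by rewrite cardC1 card_ord.
transitivity (\sum_(a : 'I_N'.+1) \sum_(s : SType K' N') \prod_j G a j (s j)).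
  rewrite exchange_big /=; apply: eq_bigr => s _.
  rewrite (bigD1 (s ord0).1)//= [X in _ = _ + X]big1 ?addr0; last first.
    move=> a neq; rewrite (bigD1 ord0)//= /G eqxx.
    by rewrite eq_sym (negPf neq) mul0r.
  rewrite (bigD1 ord0)//= {1}/G !eqxx mul1r /collisions expr_sum.
  by apply: eq_bigr => j /negPf j0; rewrite /G j0.
have N0 : N'.+1%:R != 0 :> R by rewrite pnatr_eq0.
rewrite (eq_bigr (fun=> 2%:R * ((2 * N'.+1)%:R%:P *
    (N'.+1%:R^-1 *: 'X + (1 - N'.+1%:R^-1)%:P)) ^+ K')); last first.
  move=> a _; rewrite -(bigA_distr_bigA (G a)) /= (bigD1 ord0)//=.
  congr (_ * _).
    rewrite /G eqxx (sum_v (fun b => b%:R)) /= mul0rn addr0; ring.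
  rewrite (eq_bigr (fun=> ('X + N'%:R) *+ 2)); last first.
    move=> j /negPf j0; rewrite /G j0 (sum_v (fun b => 'X^b)) /= expr1 expr0.
    by [].
  rewrite prodr_const; congr (_ ^+ _); last first.
    by rewrite cardC1 card_ord.
  rewrite mulrDr -mul_polyC mulrA -!polyCM.
  have -> : (2 * N'.+1)%:R * N'.+1%:R^-1 = 2 :> R by rewrite natrM mulfK.
  have -> : (2 * N'.+1)%:R * (1 - N'.+1%:R^-1) = (N' * 2)%:R :> R.
    by rewrite mulrBr natrM mulr1 mulfK// natrM -natr1; ring.
  by rewrite mulrnDl !polyC_natr natrM mulr_natl mulr_natr.
rewrite sumr_const card_ord exprMn -[LHS]mulr_natr mulrA mulrAC; congr (_ * _).
rewrite !polyC_natr -natrX -!natrM expnS; congr _%:R.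
by rewrite mulnAC.
Qed.

Lemma sum_collisions (F : nat -> R) :
  \sum_(s : SType K' N') ((2 * N'.+1) ^ K'.+1)%:R^-1 * F (collisions s) =
  \sum_(i < K'.+1) binomial_weight K' N'.+1%:R^-1 i * F i.
Proof.
pose c : R := ((2 * N'.+1) ^ K'.+1)%:R.
have c0 : c != 0 by rewrite pnatr_eq0 expn_eq0.
have E := collisions_generating_poly.
transitivity (\sum_(i < K'.+1) (c^-1 *: \sum_(s : SType K' N') 'X^(collisions s))`_i * F i).
  rewrite scaler_sumr; under [RHS]eq_bigr do rewrite coef_sum mulr_suml.
  rewrite exchange_big /=; apply: eq_bigr => s _.
  have lts : (collisions s < K'.+1)%N by rewrite ltnS collisions_le.
  rewrite (bigD1 (Ordinal lts))//= big1 ?addr0.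
    by rewrite coefZ coefXn eqxx mulr1.
  move=> i; rewrite coefZ coefXn -val_eqE /= => /negPf ->.
  by rewrite mulr0 mul0r.
apply: eq_bigr => i _; congr (_ * _).
rewrite E -mul_polyC mulrA -polyCM -/c mulVf// mul1r.
rewrite addrC exprDn coef_sum (bigD1 i)//= big1 ?addr0.
  rewrite exprZn -polyC_exp coefMn coefCM coefZ coefXn eqxx mulr1 /binomial_weight.
  by rewrite -[LHS]mulr_natl mulrA mulrAC.
move=> j; rewrite -val_eqE /= eq_sym => /negPf ij.
by rewrite exprZn -polyC_exp coefMn coefCM coefZ coefXn ij !mulr0 mul0rn.
Qed.

End Collisions.

(** * The receiver output given the hopping matrix *)

Section ReceiverRow.
Context {R : realType} (K' N' : nat) (s : SType K' N').
Local Notation S := (Smx s : 'M[R]_(N'.+1, K'.+1)).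

Definition chip_load (i : 'I_N'.+1) : nat := \sum_(j < K'.+1) ((s j).1 == i).

Definition chip_sign (j : 'I_K'.+1) : R := if (s j).2 then 1 else -1.

Lemma SmxE i j : S i j = chip_sign j *+ ((s j).1 == i).
Proof. by rewrite mxE /chip_sign; case: eqP. Qed.

Lemma chip_sign_sqr j : chip_sign j * chip_sign j = 1.
Proof. by rewrite /chip_sign; case: ifP => _; rewrite ?mulrNN mulr1. Qed.

(** Each column has a single nonzero entry, so no user contributes to an off-diagonal product;
    squared signs count the users of a chip. *)
Lemma Smx_gram (a : R) :
  S *m S^T + a%:M = diag_mx (\row_i ((chip_load i)%:R + a)).
Proof.
apply/matrixP => i i'; rewrite !mxE.
under eq_bigr do rewrite [S^T _ _]mxE !SmxE.
case: eqVneq => [<-|ii'].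
  rewrite !mulr1n; congr (_ + _); rewrite /chip_load natr_sum; apply: eq_bigr => j _.
  by case: eqP => _; rewrite ?mulr1n ?chip_sign_sqr// mulr0n mulr0.
rewrite !mulr0n addr0 big1// => j _.
case: eqP => [->|_]; last by rewrite mulr0n mul0r.
by rewrite (negPf ii') mulr0n mulr0.
Qed.

Lemma Wreg_entry (a : R) (j : 'I_K'.+1) (i : 'I_N'.+1) : 0 < a ->
  Wreg s a j i = (chip_sign j / ((chip_load i)%:R + a)) *+ ((s j).1 == i).
Proof.
move=> a0; rewrite /Wreg Smx_gram.
pose D := diag_mx (\row_i ((chip_load i)%:R + a)^-1) : 'M[R]_N'.+1.
have DV : diag_mx (\row_i ((chip_load i)%:R + a)) *m D = 1%:M.
  rewrite mulmx_diag; apply/matrixP => i1 i2; rewrite !mxE; case: eqP => // _.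
  by rewrite mulr1n divff// gt_eqF// ltr_wpDl.
have -> : invmx (diag_mx (\row_i ((chip_load i)%:R + a))) = D.
  have [uA _] := mulmx1_unit DV.
  by rewrite -[D]mul1mx -(mulVmx uA) -mulmxA DV mulmx1.
rewrite mul_mx_diag !mxE /chip_sign.
by case: eqP => _; rewrite ?mulr1n// mulr0n mul0r.
Qed.

(** On its own chip a user makes the load at least 1, so the limit of the inverse is taken away from
    0; on any other chip, empty ones included, the entry is 0 for every positive [a]. *)
Lemma Wdec_entry (j : 'I_K'.+1) (i : 'I_N'.+1) :
  Wdec s j i = (chip_sign j / (chip_load i)%:R) *+ ((s j).1 == i) :> R.
Proof.
rewrite mxE; apply/cvg_lim => //.
have : ((chip_sign j / ((chip_load i)%:R + a)) *+ ((s j).1 == i)) @[a --> 0^'+] -->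
    (chip_sign j / (chip_load i)%:R) *+ ((s j).1 == i).
  case: eqP => [ji|_]; last by rewrite !mulr0n; exact: cvg_cst.
  have load0 : (0 < chip_load i)%N.
    by rewrite /chip_load (bigD1 j)//= ji eqxx.
  rewrite mulr1n; apply: cvg_at_right_filter; apply: cvgM; first exact: cvg_cst.
  apply: cvgV; first by rewrite pnatr_eq0 -lt0n.
  rewrite -[X in _ --> X]addr0; apply: cvgD; [exact: cvg_cst|exact: cvg_id].
apply: cvg_trans; apply: near_eq_cvg; near=> a; rewrite Wreg_entry//.
Unshelve. all: end_near. Qed.

Lemma West_entry (a : R) (j : 'I_K'.+1) (i : 'I_N'.+1) : 0 <= a ->
  West s a j i = (chip_sign j / ((chip_load i)%:R + a)) *+ ((s j).1 == i).
Proof.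
rewrite le_eqVlt /West => /predU1P[<-|a0]; first by rewrite eqxx Wdec_entry addr0.
by rewrite gt_eqF// Wreg_entry.
Qed.

Lemma chip_load_collisions : chip_load (s ord0).1 = (collisions s).+1.
Proof. by rewrite /chip_load (bigD1 ord0)//= eqxx. Qed.

Lemma West_output (a : R) (b : 'I_K'.+1 -> R) (n : 'I_N'.+1 -> R) : 0 <= a ->
  \sum_i West s a ord0 i * (\sum_(k < K'.+1) S i k * b k + n i) =
  ((collisions s).+1%:R + a)^-1 *
  (b ord0 + (\sum_(k <- enum 'I_K'.+1 | (k != ord0) && ((s k).1 == (s ord0).1))
               chip_sign ord0 * chip_sign k * b k +
             chip_sign ord0 * n (s ord0).1)).
Proof.
move=> a0; rewrite (bigD1 (s ord0).1)//= [X in _ + X]big1 ?addr0; last first.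
  by move=> i; rewrite West_entry// eq_sym => /negPf ->; rewrite mulr0n mul0r.
rewrite West_entry// eqxx mulr1n chip_load_collisions.
rewrite mulrAC [RHS]mulrC; congr (_ * _).
rewrite mulrDr mulr_sumr (bigD1 ord0)//= SmxE eqxx mulr1n mulrA chip_sign_sqr mul1r.
rewrite -addrA; congr (_ + (_ + _)).
rewrite big_enum_cond /= [RHS]big_mkcondr /=; apply: eq_bigr => k k0.
rewrite SmxE; case: eqP => _; first by rewrite mulr1n mulrA.
by rewrite mulr0n mul0r mulr0.
Qed.

End ReceiverRow.

(** * Invariance of mutual information and of centred normal laws *)

Section MutualInfoInvariance.
Context {R : realType}.

Lemma eq_mutual_info (T : Type) (q q' : set T -> R) (X Y X' Y' : T -> R * R) :
  (forall A B, measurable A -> measurable B ->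
    q (X @^-1` A `&` Y @^-1` B) = q' (X' @^-1` A `&` Y' @^-1` B)) ->
  (forall A, measurable A -> q (X @^-1` A) = q' (X' @^-1` A)) ->
  (forall B, measurable B -> q (Y @^-1` B) = q' (Y' @^-1` B)) ->
  mutual_info q X Y = mutual_info q' X' Y'.
Proof.
move=> qXY qX qY; congr ereal_sup; apply/seteqP; split => _ /= [m1 [m2 [A [B [pA pB ->]]]]];
  exists m1, m2, A, B; split => //; congr EFin; apply: eq_bigr => i _;
  apply: eq_bigr => j _; case: pA => mA _; case: pB => mB _;
  by rewrite /= qXY// qX// qY.
Qed.

(** Data processing: a partition for [f \o Y] pulls back along [f] to one for [Y] with the same
    value. Applied to a scaling and to its inverse, it gives equality. *)
Lemma mutual_info_comp_le (T : Type) (q : set T -> R) (X Y : T -> R * R)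
    (f : R * R -> R * R) : measurable_fun setT f ->
  (mutual_info q X (f \o Y) <= mutual_info q X Y)%E.
Proof.
move=> mf; apply: le_ereal_sup => _ [m1 [m2 [A [B [pA [mB [tB cB]] ->]]]]].
exists m1, m2, A, (fun j => f @^-1` B j); split => //.
split; first by move=> i; rewrite -[_ @^-1` _]setTI; exact: mf.
split; last by move=> z; exact: cB.
by move=> i j ij; rewrite -preimage_setI tB// preimage_set0.
Qed.

Lemma mutual_info_scale (T : Type) (q : set T -> R) (X Y : T -> R * R) (c : R) :
  c != 0 -> mutual_info q X (fun w => (c * (Y w).1, c * (Y w).2)) = mutual_info q X Y.
Proof.
move=> c0; pose f (a : R) (z : R * R) := (a * z.1, a * z.2).
have mf a : measurable_fun setT (f a).
  by apply: measurable_fun_pair; apply: measurable_funM.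
apply/eqP; rewrite eq_le; apply/andP; split.
  exact: (@mutual_info_comp_le _ q X Y _ (mf c)).
have := @mutual_info_comp_le _ q X (fun w => (c * (Y w).1, c * (Y w).2)) _ (mf c^-1).
congr (mutual_info _ _ _ <= _)%E; apply/funext => w /=.
by rewrite /f /= !mulKf//; case: (Y w).
Qed.

Lemma normal_prob_sign (c s : R) (A : set R) : c * c = 1 -> 0 < s -> measurable A ->
  normal_prob 0 s ((fun x => c * x) @^-1` A) = normal_prob 0 s A.
Proof.
move=> cc s0 mA; have /eqP : c ^+ 2 = 1 by rewrite expr2.
rewrite sqrf_eq1 => /orP[] /eqP ->.
  by congr (normal_prob 0 s _); apply/seteqP; split => x /=; rewrite mul1r.
rewrite -(normal_probN s0 mA); congr (normal_prob 0 s _).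
by apply/seteqP; split => x /=; rewrite mulN1r.
Qed.

End MutualInfoInvariance.

(* Locked: when two values of [normal_prob] differ, conversion unfolds them down to the
   Lebesgue measure, which makes rewriting with several of them impracticable. *)
HB.lock Definition normal_mass {R : realType} (r : R) (A : set R) : R :=
  fine (normal_prob 0 r A).

Section NormalMass.
Context {R : realType}.

Lemma normal_mass_EFin (r : R) (A : set R) : measurable A ->
  normal_prob 0 r A = (normal_mass r A)%:E.
Proof.
by move=> mA; rewrite normal_mass.unlock fineK// fin_num_measure.
Qed.

Lemma normal_massT (r : R) : normal_mass r setT = 1.
Proof. by rewrite normal_mass.unlock (probability_setT (normal_prob 0 r)). Qed.

Lemma normal_mass_sign (c r : R) (A : set R) : c * c = 1 -> 0 < r -> measurable A ->
  normal_mass r ((fun x => c * x) @^-1` A) = normal_mass r A.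
Proof. by move=> cc r0 mA; rewrite normal_mass.unlock normal_prob_sign. Qed.

Lemma normal_sum_mass d (T : measurableType d) (Q : probability T R) (J : eqType)
    (Z : J -> T -> R) (r t : R) (l : seq J) (V : T -> R) (D : set T) (q : R) :
  measurable D -> (forall j, measurable_fun setT (Z j)) -> measurable_fun setT V ->
  0 < r -> 0 < t -> uniq l -> Q D = q%:E ->
  (forall (B : J -> set R) A, (forall j, measurable (B j)) -> measurable A ->
    Q (D `&` ([set w | forall j, j \in l -> B j (Z j w)] `&` V @^-1` A)) =
    (q * (\prod_(j <- l) normal_mass r (B j) * normal_mass t A))%:E) ->
  forall A, measurable A ->
    Q (D `&` (fun w => \sum_(j <- l) Z j w + V w) @^-1` A) =
    (q * normal_mass (Num.sqrt (\sum_(j <- l) r ^+ 2 + t ^+ 2)) A)%:E.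
Proof.
move=> mD mZ mV r0 t0 ul QD QE A mA.
have := @normal_sum_law _ _ _ Q _ Z (fun=> r) l V t D mD mZ mV (fun=> r0) t0 ul _ A mA.
rewrite QD normal_mass_EFin// => -> // B A' mB mA'.
rewrite QE// normal_mass_EFin// !EFinM; congr (_ * (_%:E * _))%E.
by apply: eq_bigr => j _; rewrite normal_mass.unlock.
Qed.

End NormalMass.

(** * The Gaussian channel given the hopping matrix *)

Section ConditionalChannel.
Context {R : realType} d (T : measurableType d) (P : probability T R).
Context (K' N' : nat) (S : T -> SType K' N').
Context (bR bI : 'I_K'.+1 -> T -> R) (nR nI : 'I_N'.+1 -> T -> R).
Variables (E N0 : R).
Hypotheses (E_gt0 : 0 < E) (N0_gt0 : 0 < N0).
Hypothesis model : th_model P S bR bI nR nI E N0.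
Variable s : SType K' N'.

Let mS : measurable [set w | S w = s]. Proof. by case: model => -[]. Qed.

Let PS_gt0 : 0 < fine (P [set w | S w = s]).
Proof.
by case: model => _ -> _ _ _; rewrite /= invr_gt0 ltr0n expn_gt0 muln_gt0.
Qed.

(** [condP] is a bare set function; this is a genuine probability measure agreeing with it on
    measurable sets. *)
Let Q : probability T R := mnormalize (mrestr P mS) P.

Let QE A : measurable A -> Q A = (condP P S s A)%:E.
Proof.
move=> mA; rewrite /Q /= /mnormalize /= /mrestr setTI.
have PS0 : P [set w | S w = s] != 0%E.
  by apply/eqP => PS0; move: PS_gt0; rewrite PS0 ltxx.
have PSfin : P [set w | S w = s] \is a fin_num by exact: fin_num_measure.
have /negPf -> : ~~ ((P [set w | S w = s] == 0%E) || (P [set w | S w = s] == +oo%E)).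
  by rewrite negb_or PS0 /=; apply: contraTN PSfin => /eqP ->.
rewrite /condP EFinM fineK//; apply: fin_num_measure; exact: measurableI.
Qed.

Let Z := Zfam bR bI nR nI.
Let sE := Num.sqrt (E / 2).
Let sN := Num.sqrt (N0 / 2).
Let sE_gt0 : 0 < sE. Proof. by rewrite sqrtr_gt0 divr_gt0. Qed.
Let sN_gt0 : 0 < sN. Proof. by rewrite sqrtr_gt0 divr_gt0. Qed.

Let mZ j : measurable_fun setT (Z j). Proof. by case: model => -[]. Qed.

Let pre (f : T -> R) A : measurable_fun setT f -> measurable A -> measurable (f @^-1` A).
Proof. by move=> mf mA; rewrite -[_ @^-1` _]setTI; exact: mf. Qed.

Let noise_sd (j : Idx K' N') : R := if j is inl _ then sE else sN.

Let Q_indep (A : Idx K' N' -> set R) : (forall j, measurable (A j)) ->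
  Q [set w | forall j, A j (Z j w)] =
  (\prod_j normal_mass (noise_sd j) (A j))%:E.
Proof.
move=> mA; have mall : measurable [set w | forall j, A j (Z j w)].
  rewrite (_ : [set w | _] = \bigcap_(j in [set: Idx K' N']) (Z j @^-1` A j)).
    by apply: fin_bigcap_measurable => [|j _]; [exact: finite_finset|exact: pre].
  by apply/seteqP; split => w /= h j; [move=> _|]; exact: h.
rewrite QE// /condP setIC; congr EFin.
case: model => _ _ hb hn -> //.
rewrite mulrAC divff ?gt_eqF// mul1r; apply: eq_bigr => -[[k|k]|[i|i]] _ /=.
- by have [-> _] := hb k _ (mA (inl (inl k))); rewrite normal_mass.unlock.
- by have [_ ->] := hb k _ (mA (inl (inr k))); rewrite normal_mass.unlock.
- by have [-> _] := hn i _ (mA (inr (inl i))); rewrite normal_mass.unlock.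
- by have [_ ->] := hn i _ (mA (inr (inr i))); rewrite normal_mass.unlock.
Qed.

Let i0 := (s ord0).1.
Let sg (k : 'I_K'.+1) : R := chip_sign s ord0 * chip_sign s k.
Let interferers := [seq k <- enum 'I_K'.+1 | (k != ord0) && ((s k).1 == i0)].
Let uR k w := sg k * bR k w.
Let uI k w := sg k * bI k w.
Let vR w := chip_sign s ord0 * nR i0 w.
Let vI w := chip_sign s ord0 * nI i0 w.

Let sg_sqr k : sg k * sg k = 1.
Proof. by rewrite /sg mulrACA !chip_sign_sqr mulr1. Qed.

Let muR k : measurable_fun setT (uR k).
Proof. by apply: measurable_funM => //; exact: (mZ (inl (inl k))). Qed.
Let muI k : measurable_fun setT (uI k).
Proof. by apply: measurable_funM => //; exact: (mZ (inl (inr k))). Qed.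
Let mvR : measurable_fun setT vR.
Proof. by apply: measurable_funM => //; exact: (mZ (inr (inl i0))). Qed.
Let mvI : measurable_fun setT vI.
Proof. by apply: measurable_funM => //; exact: (mZ (inr (inr i0))). Qed.

(** An instance of [Q_indep]: coordinates absent from [r_1] get [setT], of mass 1, and the signs are
    moved into the sets, whose normal mass they preserve by symmetry. *)
Let joint (A1 A2 A3 A4 : set R) (F1 F2 : 'I_K'.+1 -> set R) :
  measurable A1 -> measurable A2 -> measurable A3 -> measurable A4 ->
  (forall k, measurable (F1 k)) -> (forall k, measurable (F2 k)) ->
  Q (bR ord0 @^-1` A1 `&` bI ord0 @^-1` A2 `&`
     ([set w | forall k, k \in interferers -> F1 k (uR k w)] `&` vR @^-1` A3) `&`
     ([set w | forall k, k \in interferers -> F2 k (uI k w)] `&` vI @^-1` A4)) =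
  ((normal_mass sE A1 * normal_mass sE A2) *
   (\prod_(k <- interferers) normal_mass sE (F1 k) *
    normal_mass sN A3) *
   (\prod_(k <- interferers) normal_mass sE (F2 k) *
    normal_mass sN A4))%:E.
Proof.
move=> m1 m2 m3 m4 mF1 mF2.
pose scaled (c : R) (A : set R) : set R := (fun x => c * x) @^-1` A.
have mscaled c A : measurable A -> measurable (scaled c A).
  move=> mA; have mc : measurable_fun setT (fun x : R => c * x).
    exact: measurable_funM.
  by rewrite -[scaled c A]setTI; exact: mc.
pose user (A : set R) (F : 'I_K'.+1 -> set R) (k : 'I_K'.+1) : set R :=
  if k == ord0 then A else if (s k).1 == i0 then scaled (sg k) (F k) else setT.
pose chip (A : set R) (i : 'I_N'.+1) : set R :=
  if i == i0 then scaled (chip_sign s ord0) A else setT.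
pose B (j : Idx K' N') : set R := match j with
  | inl (inl k) => user A1 F1 k | inl (inr k) => user A2 F2 k
  | inr (inl i) => chip A3 i | inr (inr i) => chip A4 i end.
have muser A F : measurable A -> (forall k, measurable (F k)) ->
    forall k, measurable (user A F k).
  by move=> mA mF k; rewrite /user; case: ifP => // _; case: ifP => // _; exact: mscaled.
have mchip A : measurable A -> forall i, measurable (chip A i).
  by move=> mA i; rewrite /chip; case: ifP => // _; exact: mscaled.
have mB j : measurable (B j).
  by case: j => -[k|k] /=; [exact: muser|exact: muser|exact: mchip|exact: mchip].
have mem_int k : (k \in interferers) = (k != ord0) && ((s k).1 == i0).
  by rewrite mem_filter mem_enum andbT.
have userE A F (b : 'I_K'.+1 -> T -> R) w :
    (forall k, user A F k (b k w)) <->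
    (A (b ord0 w) /\ (forall k, k \in interferers -> F k (sg k * b k w))).
  split=> [h|[Aw Fw] k].
    split; first by have := h ord0; rewrite /user eqxx.
    move=> k; rewrite mem_int => /andP[k0 ki]; have := h k.
    by rewrite /user (negPf k0) ki.
  rewrite /user; case: eqVneq => [->//|k0]; case: ifP => // ki.
  by apply: Fw; rewrite mem_int k0.
have chipE A (n : 'I_N'.+1 -> T -> R) w :
    (forall i, chip A i (n i w)) <-> A (chip_sign s ord0 * n i0 w).
  split=> [/(_ i0)|Aw i]; first by rewrite /chip eqxx.
  by rewrite /chip; case: eqVneq => // ->.
have user_prod A F : measurable A -> (forall k, measurable (F k)) ->
    \prod_k normal_mass sE (user A F k) =
    normal_mass sE A * \prod_(k <- interferers) normal_mass sE (F k).
  move=> mA mF; rewrite (bigD1 ord0)//= {1}/user eqxx; congr (_ * _).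
  rewrite /interferers big_filter big_enum_cond /= big_mkcondr /=.
  apply: eq_bigr => k /negPf k0; rewrite /user k0; case: ifP => // _.
    by rewrite normal_mass_sign.
  exact: normal_massT.
have chip_prod A : measurable A ->
    \prod_i normal_mass sN (chip A i) = normal_mass sN A.
  move=> mA; rewrite (bigD1 i0)//= {1}/chip eqxx normal_mass_sign ?chip_sign_sqr//.
  rewrite big1 ?mulr1// => i /negPf ii0; rewrite /chip ii0.
  exact: normal_massT.
transitivity (Q [set w | forall j, B j (Z j w)]).
  congr (Q _); apply/seteqP; split => w /=.
    move=> [[[A1w A2w] [F1w A3w]] [F2w A4w]] [[k|k]|[i|i]] /=.
    - by apply: (userE A1 F1 bR w).2.
    - by apply: (userE A2 F2 bI w).2.
    - by apply: (chipE A3 nR w).2.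
    - by apply: (chipE A4 nI w).2.
  move=> h.
  have [A1w F1w] := (userE A1 F1 bR w).1 (fun k => h (inl (inl k))).
  have [A2w F2w] := (userE A2 F2 bI w).1 (fun k => h (inl (inr k))).
  have A3w := (chipE A3 nR w).1 (fun i => h (inr (inl i))).
  by have A4w := (chipE A4 nI w).1 (fun i => h (inr (inr i))).
rewrite Q_indep//; congr EFin.
rewrite big_sumType /= !big_sumType /= !user_prod// !chip_prod//.
have regroup (x1 p1 x2 p2 x3 x4 : R) :
  (x1 * p1) * (x2 * p2) * (x3 * x4) = (x1 * x2) * (p1 * x3) * (p2 * x4) by ring.
exact: regroup.
Qed.

Let gR w := \sum_(k <- interferers) uR k w + vR w.
Let gI w := \sum_(k <- interferers) uI k w + vI w.
Let t := Num.sqrt (\sum_(k <- interferers) sE ^+ 2 + sN ^+ 2).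

Let uniq_int : uniq interferers.
Proof. by rewrite filter_uniq// enum_uniq. Qed.

Let mgR : measurable_fun setT gR.
Proof. by apply: measurable_funD => //; exact: measurable_sum. Qed.
Let mgI : measurable_fun setT gI.
Proof. by apply: measurable_funD => //; exact: measurable_sum. Qed.
Let mbR : measurable_fun setT (bR ord0). Proof. exact: (mZ (inl (inl ord0))). Qed.
Let mbI : measurable_fun setT (bI ord0). Proof. exact: (mZ (inl (inr ord0))). Qed.

Let mint (u : 'I_K'.+1 -> T -> R) (F : 'I_K'.+1 -> set R) :
  (forall k, measurable_fun setT (u k)) -> (forall k, measurable (F k)) ->
  measurable [set w | forall k, k \in interferers -> F k (u k w)].
Proof.
move=> mu mF.
rewrite (_ : [set w | _] = \bigcap_(k in [set` interferers]) (u k @^-1` F k)).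
  by apply: fin_bigcap_measurable => [|k _]; [exact: finite_finset|exact: pre].
by apply/seteqP; split.
Qed.

Let prod_massT : \prod_(k <- interferers) normal_mass sE setT = 1.
Proof. by apply: big1 => k _; exact: normal_massT. Qed.

(** The real interference and noise are merged into [gR], everything else being put in [D]; [joint4]
    then does the same for the imaginary part. *)
Let joint2 (A1 A2 A3 A4 : set R) (F2 : 'I_K'.+1 -> set R) :
  measurable A1 -> measurable A2 -> measurable A3 -> measurable A4 ->
  (forall k, measurable (F2 k)) ->
  Q (bR ord0 @^-1` A1 `&` bI ord0 @^-1` A2 `&` gR @^-1` A3 `&`
     ([set w | forall k, k \in interferers -> F2 k (uI k w)] `&` vI @^-1` A4)) =
  ((normal_mass sE A1 * normal_mass sE A2) *
   normal_mass t A3 *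
   (\prod_(k <- interferers) normal_mass sE (F2 k) *
    normal_mass sN A4))%:E.
Proof.
move=> m1 m2 m3 m4 mF2.
pose D := (bR ord0 @^-1` A1 `&` bI ord0 @^-1` A2) `&`
     ([set w | forall k, k \in interferers -> F2 k (uI k w)] `&` vI @^-1` A4).
have mD : measurable D.
  apply: measurableI; first by apply: measurableI; exact: pre.
  by apply: measurableI; [exact: mint|exact: pre].
have QD : Q D = ((normal_mass sE A1 * normal_mass sE A2) *
   (\prod_(k <- interferers) normal_mass sE (F2 k) *
    normal_mass sN A4))%:E.
  have := @joint A1 A2 setT A4 (fun=> setT) F2 m1 m2 measurableT m4 (fun=> measurableT) mF2.
  rewrite /= prod_massT normal_massT !mulr1 => <-; congr (Q _).
  by apply/seteqP; split => w /= [] // [].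
have h := @normal_sum_mass _ _ _ Q _ uR sE sN interferers vR D _ mD muR mvR
  sE_gt0 sN_gt0 uniq_int QD.
rewrite [X in _ = X%:E]mulrAC.
transitivity (Q (D `&` gR @^-1` A3)).
  by rewrite /D setIAC.
apply: h => // B A mB mA.
have := joint m1 m2 mA m4 mB mF2; rewrite [X in _ = X%:E -> _]mulrAC => <-.
by rewrite /D setIAC.
Qed.

Let joint4 (A1 A2 A3 A4 : set R) :
  measurable A1 -> measurable A2 -> measurable A3 -> measurable A4 ->
  Q ((bR ord0 @^-1` A1 `&` bI ord0 @^-1` A2) `&` (gR @^-1` A3 `&` gI @^-1` A4)) =
  ((normal_prob 0 sE A1 * normal_prob 0 sE A2) *
   (normal_prob 0 t A3 * normal_prob 0 t A4))%E.
Proof.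
move=> m1 m2 m3 m4.
pose D := (bR ord0 @^-1` A1 `&` bI ord0 @^-1` A2) `&` gR @^-1` A3.
have mD : measurable D.
  by apply: measurableI; [apply: measurableI; exact: pre|exact: pre].
have QD : Q D = ((normal_mass sE A1 * normal_mass sE A2) *
   normal_mass t A3)%:E.
  have := @joint2 A1 A2 A3 setT (fun=> setT) m1 m2 m3 measurableT (fun=> measurableT).
  rewrite /= prod_massT normal_massT !mulr1 => <-; congr (Q _).
  by apply/seteqP; split => w /= [] // [].
have h := @normal_sum_mass _ _ _ Q _ uI sE sN interferers vI D _ mD muI mvI
  sE_gt0 sN_gt0 uniq_int QD (fun B A mB mA => joint2 m1 m2 m3 mA mB) A4 m4.
rewrite setIA; apply: (etrans h); rewrite -/t -mulrA.
exact: (esym (congr2 mule (congr2 mule (normal_mass_EFin sE m1) (normal_mass_EFin sE m2))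
  (congr2 mule (normal_mass_EFin t m3) (normal_mass_EFin t m4)))).
Qed.

Lemma mutual_info_given_hopping (a : R) : 0 <= a ->
  mutual_info (condP P S s) (b1 bR bI) (r1 S bR bI nR nI a) =
  (log2 (1 + (E / N0) / ((collisions s)%:R * (E / N0) + 1)))%:E.
Proof.
move=> a0; pose c : R := ((collisions s).+1%:R + a)^-1.
have c0 : c != 0 by rewrite invr_eq0 gt_eqF// ltr_wpDr.
pose Y w := (bR ord0 w + gR w, bI ord0 w + gI w).
have r1E w : S w = s -> r1 S bR bI nR nI a w = (c * (Y w).1, c * (Y w).2).
  move=> Sw; rewrite /r1 /yR /yI Sw !West_output// /Y /gR /gI /interferers.
  rewrite !big_filter; congr (_ * (_ + (_ + _)), _ * (_ + (_ + _))).
have t_gt0 : 0 < t.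
  by rewrite sqrtr_gt0 ltr_wpDl ?exprn_gt0// sumr_ge0// => k _; rewrite sqr_ge0.
(* A real component carries half the complex variance; the halves cancel in the ratio with
   [E / 2]. *)
have tE : t ^+ 2 = (collisions s)%:R * (E / 2) + N0 / 2.
  have ge0 : 0 <= \sum_(k <- interferers) sE ^+ 2 + sN ^+ 2.
    by rewrite addr_ge0 ?sqr_ge0// sumr_ge0// => k _; rewrite sqr_ge0.
  rewrite sqr_sqrtr// !sqr_sqrtr ?divr_ge0 ?ltW//; congr (_ + _).
  rewrite /interferers big_filter big_enum_cond /= /collisions natr_sum mulr_suml.
  rewrite big_mkcondr; apply: eq_bigr => k _.
  by case: ifP => _; rewrite ?mul1r ?mul0r.
have MI := mutual_info_gaussian_channel sE_gt0 t_gt0 mbR mbI mgR mgI joint4.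
transitivity (mutual_info (fun A => fine (Q A)) (fun w => (bR ord0 w, bI ord0 w))
    (fun w => (c * (Y w).1, c * (Y w).2))).
  have mX : measurable_fun setT (fun w => (bR ord0 w, bI ord0 w)).
    exact: measurable_fun_pair.
  have mcY : measurable_fun setT (fun w => (c * (Y w).1, c * (Y w).2)).
    by apply: measurable_fun_pair; apply: measurable_funM => //; exact: measurable_funD.
  have mXA A : measurable A -> measurable ((fun w => (bR ord0 w, bI ord0 w)) @^-1` A).
    by move=> mA; rewrite -[_ @^-1` _]setTI; exact: mX.
  have mYB B : measurable B -> measurable ((fun w => (c * (Y w).1, c * (Y w).2)) @^-1` B).
    by move=> mB; rewrite -[_ @^-1` _]setTI; exact: mcY.
  (* The output is a multiple of [Y] only on the event [S w = s], which is all that [condP] looks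
     at. *)
  have r1I (D : set T) B : D `&` (r1 S bR bI nR nI a) @^-1` B `&` [set w | S w = s] =
      D `&` (fun w => (c * (Y w).1, c * (Y w).2)) @^-1` B `&` [set w | S w = s].
    apply/seteqP; split => w /= [[Dw +] Sw]; split=> //; split=> //.
      by rewrite -r1E.
    by rewrite r1E.
  apply: eq_mutual_info => [A B mA mB|A mA|B mB].
  - rewrite QE /=; last by apply: measurableI; [exact: mXA|exact: mYB].
    by rewrite /condP r1I.
  - by rewrite QE//; exact: mXA.
  - rewrite QE /=; last exact: mYB.
    by have := r1I setT B; rewrite /condP !setTI => ->.
rewrite (mutual_info_scale _ _ Y c0) MI tE sqr_sqrtr ?divr_ge0 ?ltW//.
congr (log2 (1 + _))%:E; field.
have k0 : 0 <= (collisions s)%:R * E by rewrite mulr_ge0// ltW.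
by rewrite !gt_eqF// ltr_wpDl.
Qed.

End ConditionalChannel.

Lemma log2_snr_bound (R : realType) (g : R) (i : nat) : 0 < g ->
  `|log2 (1 + g / (i%:R * g + 1))| <= g / ln 2.
Proof.
move=> g0; have ln2 : 0 < ln 2 :> R by rewrite ln_gt0// ltr1n.
have den : 1 <= i%:R * g + 1 by rewrite lerDr mulr_ge0// ltW.
have x0 : 0 <= g / (i%:R * g + 1) by rewrite divr_ge0 ?ltW// (lt_le_trans _ den).
rewrite /log2 ger0_norm; last by rewrite divr_ge0 ?(ltW ln2)// ln_ge0// lerDl.
rewrite ler_pM2r ?invr_gt0//; apply: le_trans (le_ln1Dx _) _.
  exact: lt_le_trans x0.
by rewrite ler_pdivrMr ?ler_peMr// ?(lt_le_trans _ den)// ltW.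
Qed.

Unset Implicit Arguments. Set Strict Implicit. Set Printing Implicit Defensive.

(* For n : nat, N = n.+1 chips and K = (k n).+1 users. *)
Theorem theorem6 (R : realType) (d : measure_display) (T : measurableType d)
  (P : probability T R) (beta E N0 alpha : R) (k : nat -> nat)
  (S : forall n, T -> SType (k n) n)
  (bR bI : forall n, 'I_(k n).+1 -> T -> R)
  (nR nI : forall n, 'I_n.+1 -> T -> R) :
  0 < beta -> 0 < E -> 0 < N0 ->
  (fun n => ((k n).+1)%:R / (n.+1)%:R : R) @ \oo --> beta ->
  (forall n, th_model P (S n) (bR n) (bI n) (nR n) (nI n) E N0) ->
  (alpha = 0 \/ alpha = (E / N0)^-1) ->
  (fun n => (beta%:E *
     cond_mi P (S n) (b1 (bR n) (bI n))
       (r1 (S n) (bR n) (bI n) (nR n) (nI n) alpha))%E)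
  @ \oo -->
  (beta * limn (series (fun i : nat =>
     beta ^+ i * expR (- beta) / (i`!)%:R *
      log2 (1 + (E / N0) / (i%:R * (E / N0) + 1)))))%:E.
Proof.
move=> beta0 E0 N00 kN model alphaE.
have g0 : 0 < E / N0 by rewrite divr_gt0.
have a0 : 0 <= alpha by case: alphaE => -> //; rewrite invr_ge0 ltW.
pose F i := log2 (1 + (E / N0) / (i%:R * (E / N0) + 1)).
pose p n : R := n.+1%:R^-1.
have p0 : p n @[n --> \oo] --> 0 by exact: cvg_harmonic.
(* Only the [k n] users other than the first can collide with it; the difference from [(k n).+1] is
   [p n], which vanishes. *)
have kp : ((k n)%:R * p n) @[n --> \oo] --> beta.
  have -> : (fun n => (k n)%:R * p n) = (fun n => (k n).+1%:R / n.+1%:R - p n).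
    by apply/funext => n; rewrite -natr1 mulrDl mul1r addrK.
  by rewrite -[X in _ --> X]subr0; exact: cvgB.
have cond_miE n : (beta%:E * cond_mi P (S n) (b1 (bR n) (bI n))
    (r1 (S n) (bR n) (bI n) (nR n) (nI n) alpha))%E =
    (beta * \sum_(i < (k n).+1) binomial_weight (k n) (p n) i * F i)%:E.
  rewrite EFinM -(sum_collisions _ n) -sumEFin; congr (_ * _)%E.
  apply: eq_bigr => s _; rewrite (mutual_info_given_hopping E0 N00 (model n) s a0).
  by case: (model n) => _ -> _ _ _.
under eq_fun do rewrite cond_miE.
apply: cvg_EFin; first exact: nearW.
apply: cvgM; first exact: cvg_cst.
apply: binomial_poisson_expectation p0 kp _ => [n|n|i].
- by rewrite invr_ge0.
- by rewrite invf_le1// ler1n.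
- exact: log2_snr_bound.
Qed.
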